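(* Let $k\ge1$, let $d_1,\dots,d_k$ be positive integers, and suppose $$F=x_0^{a_0}x_1^{a_1}x_2^{a_2}\otimes y_{2,0}^{b_{2,0}}y_{2,1}^{b_{2,1}}\otimes\dots\otimes y_{k,0}^{b_{k,0}}y_{k,1}^{b_{k,1}}\in S^{d_1}\mathbb{C}^3\otimes S^{d_2}\mathbb{C}^2\otimes\dots\otimes S^{d_k}\mathbb{C}^2,$$ where $a_0\ge a_1\ge a_2\ge 0$ and $b_{i,0}\ge b_{i,1}\ge 0$ for all $i=2,\dots,k$ (so $a_0+a_1+a_2=d_1$ and $b_{i,0}+b_{i,1}=d_i$). Then the border rank of $F$ with respect to $\mathbb{P}^2\times\mathbb{P}^1\times\dots\times\mathbb{P}^1$ (with $k-1$ factors $\mathbb{P}^1$) is $$(a_1+1)(a_2+1)(b_{2,1}+1)\cdots(b_{k,1}+1).$$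
   Context: Here $x_0,x_1,x_2$ is a basis of $\mathbb{C}^3$ and $y_{i,0},y_{i,1}$ is a basis of the $i$-th tensor factor's $\mathbb{C}^2$. The variety $X=\mathbb{P}^2\times\mathbb{P}^1\times\dots\times\mathbb{P}^1$ is embedded in $\mathbb{P}(S^{d_1}\mathbb{C}^3\otimes S^{d_2}\mathbb{C}^2\otimes\dots\otimes S^{d_k}\mathbb{C}^2)$ by the Segre–Veronese map $([\ell_1],\dots,[\ell_k])\mapsto[\ell_1^{d_1}\otimes\dots\otimes\ell_k^{d_k}]$. The border rank of $F$ with respect to $X$ is the least $r$ such that $[F]$ lies in the $r$-th secant variety $\sigma_r(X)=\overline{\bigcup\{\langle p_1,\dots,p_r\rangle\mid p_i\in X\}}$. The base field is $\mathbb{C}$. *)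

(* Defs.v *)
From mathcomp Require Import all_boot all_order all_algebra.
From mathcomp Require Import reals.
From mathcomp Require Import complex.
From mathcomp Require Import mpoly.

Set Implicit Arguments.
Unset Strict Implicit.
Unset Printing Implicit Defensive.

Import GRing.Theory.
Local Open Scope ring_scope.

(* The tensor space S^d1 C^3 (x) S^(d 0) C^2 (x) ... (x) S^(d (n-1)) C^2 is
   represented as the multihomogeneous component of multidegree
   (d1, d 0, ..., d (n-1)) of the polynomial ring in the 3 + 2n variables
   x_0, x_1, x_2, y_(i,0), y_(i,1) (i < n): S^d C^m is the space of forms of
   degree d in m variables, and the tensor product of forms in disjoint sets of
   variables is their product.  A point of the projective space of tensors is
   given by a nonzero representative. *)

Notation nvars n := (3 + n * 2)%N.

Definition xvar n (j : 'I_3) : 'I_(nvars n) := lshift (n * 2) j.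
Definition yvar n (i : 'I_n) (j : 'I_2) : 'I_(nvars n) :=
  rshift 3 (mxvec_index i j).

Definition has_multidegree n (d1 : nat) (d : 'I_n -> nat)
    (m : 'X_{1..(nvars n)}) : bool :=
  ((\sum_(j < 3) m (xvar n j))%N == d1) &&
  [forall i, (\sum_(j < 2) m (yvar i j))%N == d i].

Section SegreVeronese.
Variables (K : fieldType) (n d1 : nat) (d : 'I_n -> nat).

Local Notation poly := {mpoly K[nvars n]}.

Definition is_tensor (F : poly) : bool := all (has_multidegree d1 d) (msupp F).

(* The monomials of multidegree (d1, d): a basis of the tensor space.  The
   bound on the total degree only serves to obtain a finite type. *)
Definition basis_mnm : finType :=
  {m : 'X_{1..(nvars n) < (d1 + \sum_(i < n) d i).+1%N} | has_multidegree d1 d m}.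

Definition coords (F : poly) : 'I_#|basis_mnm| -> K :=
  fun i => F@_(val (enum_val i)).

Definition xform (u : 'rV[K]_3) : poly := \sum_(j < 3) u 0 j *: 'X_(xvar n j).
Definition yform (i : 'I_n) (v : 'rV[K]_2) : poly :=
  \sum_(j < 2) v 0 j *: 'X_(yvar i j).

Definition segre_veronese (u : 'rV[K]_3) (v : 'I_n -> 'rV[K]_2) : poly :=
  xform u ^+ d1 * \prod_(i < n) yform i (v i) ^+ d i.

Definition in_X (p : poly) : Prop :=
  exists (u : 'rV[K]_3) (v : 'I_n -> 'rV[K]_2),
    [/\ u != 0, forall i, v i != 0 & p = segre_veronese u v].

Definition in_span_of_points (r : nat) (G : poly) : Prop :=
  exists (p : 'I_r -> poly) (c : 'I_r -> K),
    (forall s, in_X (p s)) /\ G = \sum_(s < r) c s *: p s.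

(* Projective Zariski closure of (the image in projective space of) S: the
   common zeros of the homogeneous polynomials in the coordinates of the tensor
   space that vanish on S. *)
Definition zariski_closure (S : poly -> Prop) (F : poly) : Prop :=
  forall (e : nat) (P : {mpoly K[#|basis_mnm|]}),
    P \is e.-homog ->
    (forall G, S G -> P.@[coords G] = 0) -> P.@[coords F] = 0.

Definition in_secant (r : nat) (F : poly) : Prop :=
  [/\ is_tensor F, F != 0 & zariski_closure (in_span_of_points r) F].

Definition is_border_rank (F : poly) (r : nat) : Prop :=
  in_secant r F /\ forall s, in_secant s F -> (r <= s)%N.

End SegreVeronese.

Definition monomial_tensor (K : fieldType) n (a0 a1 a2 : nat)
    (b0 b1 : 'I_n -> nat) : {mpoly K[nvars n]} :=
  'X_(xvar n 0) ^+ a0 * 'X_(xvar n 1) ^+ a1 * 'X_(xvar n 2) ^+ a2 *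
  \prod_(i < n) ('X_(yvar i 0) ^+ b0 i * 'X_(yvar i 1) ^+ b1 i).

(* Main.v *)
Require Import Defs.
From mathcomp Require Import all_boot all_order all_algebra.
From mathcomp Require Import reals.
From mathcomp Require Import complex.
From mathcomp Require Import mpoly.
From mathcomp Require Import zify ring.
From mathcomp Require boolp classical_sets.

(** Up to a nonzero multinomial factor depending only on the monomial m, the
    coefficient at m of a point of X is the value of m at the vectors defining
    the point.  A combination of points with weights c_t is therefore the
    functional sending a form g to the sum of the c_t g(p_t), and F corresponds
    to the functional that is 1 on its own exponent and 0 on the others.

    Upper bound.  Take the points (1, z xi, z eta; 1, z zeta_i) with xi, eta and
    zeta_i running over a1 + 1, a2 + 1 and b_(i,1) + 1 distinct values, and
    product weights whose moments of order at most a1, a2, b_(i,1) vanish except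
    the top ones, which are 1.  A monomial then gets a nonzero value only if its
    exponents reach these numbers, so after division by the right power of z the
    combination is polynomial in z, with value F at z = 0
    ([monomial_in_secant_closure]).

    Lower bound.  Let F be in the closure of the combinations of s points.  The
    combination of s generic points has coordinates in a function field L, and
    the closure condition says that the polynomials in these coordinates which
    vanish at F form a proper ideal of the ring they generate
    ([closure_ring_ideal]).  Some valuation ring of L dominates this pair
    ([valuation_dominating]), so F is a limit of the generic combination.

    Consider the monomials of degree n in x_0, x_1, x_2 times the monomials of
    degree b_(i,1) in the y_i, evaluated at the generic points.  Order the terms
    of a linear relation between these values by valuation, then by a monomial
    order: its largest term is its leading monomial.  The monomials that lead no
    relation are called standard; they are the standard monomials of an initial
    ideal of the limit of the ideals of the points.  There are as many of them
    as the rank of the evaluation, so at most s, and at most as many in degree n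
    as in degree n + 1 because x_0 vanishes at no generic point.  A divisor of a
    standard monomial is standard, and so is every monomial in the box, meaning
    with x-exponents at most (a_0, a_1, a_2): a relation led by it would be
    contradicted by pairing with the complementary factor of F, which F sees.

    Put n = a1 + a2.  Exactly N = (a1 + 1)(a2 + 1) prod (b_(i,1) + 1) monomials
    have x_1- and x_2-exponents at most a1 and a2.  When a0 >= n all of them are
    in the box and N <= s.  When a0 < n, the box lacks the set R of the
    monomials with x_0-exponent above a0, and counting in one degree is not
    enough.  Suppose that fewer than N monomials are standard and let q and q'
    be the numbers of standard monomials outside the box in degrees n and n + 1.
    They are closed under divisors as long as these stay outside the box, so
    weighted double counting of divisibilities gives, with i = n - a0 - 1,
    (i + 1) q' <= (i + 3) q, while the sets R and R' of the two degrees, being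
    complete, satisfy (i + 1) |R'| = (i + 3) |R|.  But q < |R|, and the
    monotonicity of the number of standard monomials forces
    q' - q >= |R'| - |R|, a contradiction ([card_growth_lower],
    [number_of_points]). *)

Set Implicit Arguments.
Unset Strict Implicit.
Unset Printing Implicit Defensive.

Import Order.TTheory GRing.Theory Num.Theory.
Local Open Scope ring_scope.

(** * Valuation rings dominating a ring and a proper ideal *)

(** Maximal elements for [dominates] turn out to be valuation rings with their
    maximal ideals.  The ideal is only asked to be proper, so that enlargements are
    easy to build. *)
Record ring_ideal (L : fieldType) := RingIdeal {
  in_ring : L -> Prop;
  in_ideal : L -> Prop;
  in_ring1 : in_ring 1;
  in_ringB : forall x y, in_ring x -> in_ring y -> in_ring (x - y);
  in_ringM : forall x y, in_ring x -> in_ring y -> in_ring (x * y);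
  in_ideal0 : in_ideal 0;
  in_idealB : forall x y, in_ideal x -> in_ideal y -> in_ideal (x - y);
  in_idealM : forall x y, in_ring x -> in_ideal y -> in_ideal (x * y);
  ideal_in_ring : forall x, in_ideal x -> in_ring x;
  ideal_proper : ~ in_ideal 1 }.

Definition dominates (L : fieldType) (P Q : ring_ideal L) : Prop :=
  (forall x, in_ring P x -> in_ring Q x) /\
  (forall x, in_ideal P x -> in_ideal Q x).

Section RingIdealTheory.
Variables (L : fieldType) (P : ring_ideal L).
Implicit Types x y : L.

Lemma in_ring0 : in_ring P 0.
Proof. by rewrite -(subrr 1); apply: in_ringB; exact: in_ring1. Qed.
Lemma in_ringN x : in_ring P x -> in_ring P (- x).
Proof. by rewrite -sub0r; apply: in_ringB; exact: in_ring0. Qed.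
Lemma in_ringD x y : in_ring P x -> in_ring P y -> in_ring P (x + y).
Proof. by move=> Hx /in_ringN Hy; rewrite -[y]opprK; apply: in_ringB. Qed.
Lemma in_ringX x n : in_ring P x -> in_ring P (x ^+ n).
Proof.
move=> Hx; elim: n => [|n IH]; first exact: in_ring1.
by rewrite exprS; apply: in_ringM.
Qed.
Lemma in_idealN x : in_ideal P x -> in_ideal P (- x).
Proof. by rewrite -sub0r; apply: in_idealB; exact: in_ideal0. Qed.
Lemma in_idealD x y : in_ideal P x -> in_ideal P y -> in_ideal P (x + y).
Proof. by move=> Hx /in_idealN Hy; rewrite -[y]opprK; apply: in_idealB. Qed.
Lemma in_idealMr x y : in_ideal P x -> in_ring P y -> in_ideal P (x * y).
Proof. by rewrite mulrC => Hx Hy; apply: in_idealM. Qed.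
Lemma in_ideal_sum (I : Type) (r : seq I) (Q : pred I) (F : I -> L) :
  (forall i, Q i -> in_ideal P (F i)) -> in_ideal P (\sum_(i <- r | Q i) F i).
Proof.
by move=> H; apply: big_ind => //; [exact: in_ideal0 | exact: in_idealD].
Qed.
Lemma in_ring_sum (I : Type) (r : seq I) (Q : pred I) (F : I -> L) :
  (forall i, Q i -> in_ring P (F i)) -> in_ring P (\sum_(i <- r | Q i) F i).
Proof.
by move=> H; apply: big_ind => //; [exact: in_ring0 | exact: in_ringD].
Qed.

(** Such a p is the obstruction to adjoining x: it says that the extension of the
    ideal to the ring generated by x is the unit ideal. *)
Definition unit_relation x (p : {poly L}) : Prop :=
  (forall i, in_ideal P p`_i) /\ p.[x] = 1.

Definition adjoin (S : L -> Prop) x y : Prop :=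
  exists p : {poly L}, (forall i, S p`_i) /\ y = p.[x].

Lemma adjoin_const (S : L -> Prop) x y : S 0 -> S y -> adjoin S x y.
Proof.
move=> S0 Sy; exists y%:P; split; last by rewrite hornerC.
by move=> i; rewrite coefC; case: eqP.
Qed.

Lemma adjoinB (S : L -> Prop) x y z :
  (forall a b, S a -> S b -> S (a - b)) ->
  adjoin S x y -> adjoin S x z -> adjoin S x (y - z).
Proof.
move=> SB [p [Hp ->]] [q [Hq ->]]; exists (p - q); split=> [i|].
  by rewrite coefB; apply: SB.
by rewrite hornerD hornerN.
Qed.

(** The extension of the ideal to the ring generated by x stays proper, since
    [1 = p.[x]] with p over the ideal is a unit relation. *)
Lemma adjoin_ring_ideal x : (forall p, ~ unit_relation x p) ->
  exists Q : ring_ideal L, dominates P Q /\ in_ring Q x.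
Proof.
move=> nrel.
have A0 := in_ring0; have I0 := in_ideal0 P; have AB := @in_ringB _ P.
have IB := @in_idealB _ P.
unshelve eexists (@RingIdeal L (adjoin (in_ring P) x) (adjoin (in_ideal P) x)
  _ _ _ _ _ _ _ _).
- by apply: adjoin_const => //; exact: in_ring1.
- by move=> y z; apply: adjoinB.
- move=> y z [p [Hp ->]] [q [Hq ->]]; exists (p * q); split=> [i|].
    by rewrite coefM; apply: in_ring_sum => k _; apply: in_ringM.
  by rewrite hornerM.
- by apply: adjoin_const.
- by move=> y z; apply: adjoinB.
- move=> y z [p [Hp ->]] [q [Hq ->]]; exists (p * q); split=> [i|].
    by rewrite coefM; apply: in_ideal_sum => k _; apply: in_idealM.
  by rewrite hornerM.
- by move=> y [p [Hp ->]]; exists p; split=> // i; apply: ideal_in_ring.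
- by move=> [p [Hp E]]; apply: (nrel p).
split=> /=; first by split=> y Hy; apply: adjoin_const.
exists 'X; split=> [i|]; last by rewrite hornerX.
by rewrite coefX; case: eqP => _; [exact: in_ring1 | exact: A0].
Qed.

Lemma add_ideal_generator a : in_ring P a ->
  (forall i b, in_ideal P i -> in_ring P b -> i + a * b <> 1) ->
  exists Q : ring_ideal L, dominates P Q /\ in_ideal Q a.
Proof.
move=> Ha prop.
pose J y := exists i b, [/\ in_ideal P i, in_ring P b & y = i + a * b].
unshelve eexists (@RingIdeal L (in_ring P) J _ _ _ _ _ _ _ _).
- exact: in_ring1.
- exact: in_ringB.
- exact: in_ringM.
- exists 0, 0; split; [exact: in_ideal0|exact: in_ring0|].
  by rewrite mulr0 addr0.
- move=> _ _ [i [b [Hi Hb ->]]] [j [c [Hj Hc ->]]]; exists (i - j), (b - c).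
  by split; [exact: in_idealB|exact: in_ringB|rewrite mulrBr opprD addrACA].
- move=> y _ Hy [i [b [Hi Hb ->]]]; exists (y * i), (y * b).
  by split; [exact: in_idealM|exact: in_ringM|rewrite mulrDr mulrCA].
- move=> _ [i [b [Hi Hb ->]]]; apply: in_ringD; first exact: ideal_in_ring.
  exact: in_ringM.
- by move=> [i [b [Hi Hb /esym]]]; apply: prop.
split=> /=; first split=> // y Hy.
  by exists y, 0; split; [|exact: in_ring0|rewrite mulr0 addr0].
by exists 0, 1; split; [exact: in_ideal0|exact: in_ring1|rewrite add0r mulr1].
Qed.

End RingIdealTheory.

Section Maximal.
Variables (L : fieldType) (P : ring_ideal L).
Hypothesis maxP : forall Q, dominates P Q -> dominates Q P.

Lemma max_ring x : (forall p, ~ unit_relation P x p) -> in_ring P x.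
Proof. by move=> /adjoin_ring_ideal [Q [/maxP [H _]]] /H. Qed.

(** By maximality the ideal is radical: from a proper power a ^+ n and
    [1 = i + a * b] one descends to 1 in the ideal, so a can be added to it. *)
Lemma max_ideal_pow a n : in_ring P a -> in_ideal P (a ^+ n) -> in_ideal P a.
Proof.
move=> Ha Han; have [] := @add_ideal_generator _ P a Ha; last first.
  by move=> Q [/maxP [_ H]] /H.
move=> i b Hi Hb E; apply: (@ideal_proper _ P).
elim: n Han => [|n IH]; rewrite ?expr0 // => Han; apply: IH.
have ->: a ^+ n = i * a ^+ n + b * a ^+ n.+1.
  by rewrite exprS mulrA [b * a]mulrC -mulrDl E mul1r.
by apply: in_idealD; [apply: in_idealMr => //; exact: in_ringX|apply: in_idealM].
Qed.

(** Dividing the relation by the top power of x writes a power of 1/x as a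
    combination of powers of 1/x with coefficients in the ideal. *)
Lemma max_dichotomy x p : x != 0 -> unit_relation P x p ->
  in_ring P x^-1 -> in_ideal P x^-1.
Proof.
move=> x0 [Hp E] Hy; apply: (@max_ideal_pow _ (size p)) => //.
rewrite -[X in in_ideal P X]mul1r -E horner_coef big_distrl /=.
apply: in_ideal_sum => i _; rewrite -mulrA; apply: in_idealMr => //.
have -> : x ^+ i * x^-1 ^+ size p = x^-1 ^+ (size p - i).
  have := subnKC (ltnW (ltn_ord i)); move: (size p) (nat_of_ord i) => n k nk.
  by rewrite -{1}nk exprD mulrA -exprMn divff // expr1n mul1r.
exact: in_ringX.
Qed.

Lemma max_inv a : in_ring P a -> ~ in_ideal P a -> in_ring P a^-1.
Proof.
move=> Ha na; have [->|a0] := eqVneq a 0.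
  by rewrite invr0; exact: in_ring0.
apply: max_ring => p Hp; apply: na; rewrite -[a]invrK.
by apply: (max_dichotomy _ Hp); rewrite ?invr_eq0 // invrK.
Qed.

(** A relation 1 = q_0 + q_1 / x + ... for 1/x has [1 - q_0] invertible, hence
    expresses x ^+ m through lower powers with coefficients in the ideal; this
    replaces the top term of the relation for x. *)
Lemma unit_relation_lower x (p q : {poly L}) : x != 0 ->
  unit_relation P x p -> unit_relation P x^-1 q -> (size q <= size p)%N ->
  exists2 p', unit_relation P x p' & (size p' < size p)%N.
Proof.
move=> x0 [Hp Ep] [Hq Eq] sqp.
have c0 : in_ring P (1 - q`_0)^-1.
  apply: max_inv.
    by apply: in_ringB; [exact: in_ring1|exact: ideal_in_ring].
  move=> H; apply: (@ideal_proper _ P).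
  by rewrite -(subrK q`_0 1); apply: in_idealD.
have c1 : 1 - q`_0 != 0.
  apply/eqP => H; apply: (@ideal_proper _ P).
  by rewrite -(subrK q`_0 1) H add0r.
have sp : (0 < size p)%N.
  rewrite lt0n size_poly_eq0; apply: contraPneq Ep => ->.
  by rewrite horner0 => /esym/eqP; rewrite (negPf (oner_neq0 _)).
pose m := (size p).-1.
have sm : size p = m.+1 by rewrite prednK.
have Exm : x ^+ m = \sum_(i < m) ((1 - q`_0)^-1 * q`_i.+1) * x ^+ (m - i.+1).
  transitivity ((1 - q`_0)^-1 * ((1 - q`_0) * x ^+ m)).
    by rewrite mulrA mulVf // mul1r.
  under eq_bigr do rewrite -mulrA.
  rewrite -big_distrr /=; congr (_ * _).
  rewrite mulrBl mul1r -{1}[x ^+ m]mul1r -Eq.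
  rewrite (@horner_coef_wide _ m.+1); last by rewrite -sm.
  rewrite big_ord_recl expr0 mulr1 mulrDl addrAC subrr add0r big_distrl /=.
  apply: eq_bigr => i _; rewrite -mulrA; congr (_ * _).
  rewrite /bump leq0n add1n; have := subnK (ltn_ord i).
  move: (nat_of_ord i).+1 => k nk; rewrite -{1}nk exprD exprVn mulrCA.
  by rewrite mulVf ?mulr1 // expf_neq0.
pose w : {poly L} := \sum_(i < m) ((1 - q`_0)^-1 * q`_i.+1) *: 'X^(m - i.+1).
have Hw k : in_ideal P w`_k.
  rewrite coef_sum; apply: in_ideal_sum => i _; rewrite coefZ coefXn.
  apply: in_idealMr; first exact: in_idealM.
  by case: eqP => _; [exact: in_ring1|exact: in_ring0].
have Ew : w.[x] = x ^+ m.
  by rewrite Exm horner_sum; apply: eq_bigr => i _; rewrite hornerZ hornerXn.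
have sw : (size w <= m)%N.
  apply: (leq_trans (size_sum _ _ _)); apply/bigmax_leqP => i _.
  apply: (leq_trans (size_scale_leq _ _)); rewrite size_polyXn.
  by rewrite subnS prednK ?subn_gt0 // leq_subr.
pose p' := \poly_(i < m) p`_i + p`_m *: w.
exists p'; last first.
  rewrite sm ltnS (leq_trans (size_polyD _ _)) // geq_max size_poly.
  exact: leq_trans (size_scale_leq _ _) sw.
split=> [i|].
  rewrite coefD coefZ coef_poly; apply: in_idealD.
    by case: ifP => _ //; exact: in_ideal0.
  by apply: in_idealM => //; exact: ideal_in_ring.
rewrite hornerD hornerZ Ew -Ep [in RHS](@horner_coef _ p) sm big_ord_recr /=.
by rewrite horner_poly.
Qed.

Lemma no_two_unit_relations x p q : x != 0 ->
  unit_relation P x p -> unit_relation P x^-1 q -> False.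
Proof.
have [n] := ubnP (size p + size q); elim: n x p q => // n IH x p q Hn x0 Hp Hq.
have [le|/ltnW le] := leqP (size q) (size p).
  have [p' Hp' lt'] := unit_relation_lower x0 Hp Hq le.
  apply: (IH x p' q) => //; rewrite ltnS in Hn; apply: leq_trans Hn.
  by rewrite ltn_add2r.
have Hp1 : unit_relation P x^-1^-1 p by rewrite invrK.
have y0 : x^-1 != 0 by rewrite invr_eq0.
have [q' Hq' lt'] := unit_relation_lower y0 Hq Hp1 le.
apply: (IH x p q') => //; rewrite ltnS in Hn; apply: leq_trans Hn.
by rewrite ltn_add2l.
Qed.

Lemma max_valuation x : in_ring P x \/ in_ideal P x^-1.
Proof.
have [->|x0] := eqVneq x 0; first by left; exact: in_ring0.
case: (boolp.lem (exists p, unit_relation P x p)) => [[p Hp]|H]; last first.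
  by left; apply: max_ring => p Hp; apply: H; exists p.
right; apply: (max_dichotomy x0 Hp); apply: max_ring => q Hq.
exact: no_two_unit_relations Hp Hq.
Qed.

End Maximal.

(** A maximal pair above the given one exists by Zorn's lemma, unions of chains
    being pairs again. *)
Theorem valuation_dominating (L : fieldType) (P0 : ring_ideal L) :
  exists P : ring_ideal L, dominates P0 P /\
    forall x, in_ring P x \/ in_ideal P x^-1.
Proof.
pose T := sig (dominates P0).
pose R (P Q : T) := boolp.asbool (dominates (sval P) (sval Q)).
have refl0 : dominates P0 P0 by [].
have [||F Ftot|M maxM] := @classical_sets.ZL_preorder T (exist _ P0 refl0) R.
- by move=> P; apply/boolp.asboolP.
- move=> P Q S /boolp.asboolP [H1 H2] /boolp.asboolP [H3 H4].
  by apply/boolp.asboolP; split=> x Hx; [apply/H3/H1|apply/H4/H2].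
- case: (boolp.lem (exists P, F P)) => [[S FS]|nF]; last first.
    by exists (exist _ P0 refl0) => P FP; case: nF; exists P.
  have two (G : ring_ideal L -> L -> Prop) x y :
      (forall P Q, dominates P Q -> forall z, G P z -> G Q z) ->
      (exists2 P, F P & G (sval P) x) -> (exists2 P, F P & G (sval P) y) ->
      exists P, [/\ F P, G (sval P) x & G (sval P) y].
    move=> mono [P FP Px] [Q FQ Qy].
    case: (Ftot P Q FP FQ) => /boolp.asboolP dom.
      by exists Q; split=> //; apply: mono dom _ _.
    by exists P; split=> //; apply: mono dom _ _.
  have mr (P Q : ring_ideal L) : dominates P Q -> forall z, in_ring P z -> in_ring Q z.
    by case.
  have mi (P Q : ring_ideal L) : dominates P Q -> forall z, in_ideal P z -> in_ideal Q z.
    by case.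
  unshelve epose (U := (@RingIdeal L (fun x => exists2 P, F P & in_ring (sval P) x)
    (fun x => exists2 P, F P & in_ideal (sval P) x) _ _ _ _ _ _ _ _)).
  + by exists S => //; exact: in_ring1.
  + move=> x y Hx Hy; have [P [FP Px Py]] := two _ _ _ mr Hx Hy.
    by exists P => //; apply: in_ringB.
  + move=> x y Hx Hy; have [P [FP Px Py]] := two _ _ _ mr Hx Hy.
    by exists P => //; apply: in_ringM.
  + by exists S => //; exact: in_ideal0.
  + move=> x y Hx Hy; have [P [FP Px Py]] := two _ _ _ mi Hx Hy.
    by exists P => //; apply: in_idealB.
  + move=> x y [P FP Px] [Q FQ Qy].
    case: (Ftot P Q FP FQ) => /boolp.asboolP dom.
      by exists Q => //; apply: in_idealM => //; apply: mr dom _ _.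
    by exists P => //; apply: in_idealM => //; apply: mi dom _ _.
  + by move=> x [P FP Px]; exists P => //; apply: ideal_in_ring.
  + by move=> [P FP]; apply: ideal_proper.
  have U0 : dominates P0 U.
    by split=> x Hx; exists S => //; case: (svalP S) => H1 H2; [apply: H1|apply: H2].
  exists (exist _ U U0) => P FP; apply/boolp.asboolP.
  by split=> x Hx /=; exists P.
exists (sval M); split; first exact: svalP M.
move=> x; apply: max_valuation => Q MQ.
have Q0 : dominates P0 Q.
  case: (svalP M) => H1 H2; case: MQ => H3 H4.
  by split=> y Hy; [apply/H3/H1|apply/H4/H2].
have /boolp.asboolP := maxM (exist _ Q Q0) (introT (boolp.asboolP _) MQ).
by [].
Qed.

(** * Leading indices of linear relations over a valued field *)

Section Leading.
Variables (L : fieldType) (P : ring_ideal L).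
Hypothesis valV : forall x, in_ring P x \/ in_ideal P x^-1.

(** The leading entry has the largest size for the valuation, and among the
    entries of that size the largest key: later entries lie in the ideal. *)
Definition leads (T : finType) (key : T -> nat) (v : T -> L) (t : T) : Prop :=
  v t = 1 /\ forall t', in_ring P (v t') /\
    ((key t < key t')%N -> in_ideal P (v t')).

(** Any two nonzero entries are comparable by the valuation, ties being decided
    by the key, so a largest entry can be found by a linear scan. *)
Lemma exists_leading (T : finType) (key : T -> nat) (v : T -> L) t0 :
  v t0 != 0 -> exists2 t, v t != 0 & leads key (fun t' => v t' / v t) t.
Proof.
move=> vt0.
pose good t t' := in_ring P (v t' / v t) /\
      ((key t < key t')%N -> in_ideal P (v t' / v t)).
have good0 t t' : v t' = 0 -> good t t'.
  by rewrite /good => ->; rewrite mul0r; split=> [|_]; [exact: in_ring0|exact: in_ideal0].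
have good1 t : v t != 0 -> good t t.
  by rewrite /good => vt; rewrite divff // ltnn; split=> //; exact: in_ring1.
have [H|[t vt Ht]] : (forall t, t \in enum T -> v t = 0) \/
    exists2 t, v t != 0 & forall t', t' \in enum T -> good t t'.
- elim: (enum T) => [|a r [IH|[t vt Ht]]]; first by left.
  + have [va|va] := eqVneq (v a) 0.
      by left=> t; rewrite inE => /orP [/eqP ->|/IH].
    right; exists a => // t'; rewrite inE => /orP [/eqP ->|/IH]; last exact: good0.
    exact: good1.
  right.
  have [va|va] := eqVneq (v a) 0.
    exists t => // t'; rewrite inE => /orP [/eqP ->|/Ht //]; exact: good0.
  have keep : good t a ->
    exists2 t, v t != 0 & forall t', t' \in a :: r -> good t t'.
    by move=> ga; exists t => // t'; rewrite inE => /orP [/eqP ->|/Ht].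
  have change : in_ring P (v t / v a) ->
    ((key t <= key a)%N \/ in_ideal P (v t / v a)) ->
    exists2 t, v t != 0 & forall t', t' \in a :: r -> good t t'.
    move=> ra la; exists a => // t'; rewrite inE => /orP [/eqP ->|/Ht [h1 h2]].
      exact: good1.
    have E : v t' / v a = (v t' / v t) * (v t / v a) by rewrite mulrA divfK.
    rewrite /good E; split; first exact: in_ringM.
    move=> ka; case: la => [la|la]; last exact: in_idealM.
    by apply: in_idealMr => //; apply: h2; exact: leq_ltn_trans la ka.
  have [ra|] := valV (v a / v t); last first.
    by rewrite invf_div => ia; apply: change; [exact: ideal_in_ring|right].
  have [|] := valV (v t / v a); last first.
    by rewrite invf_div => ia; apply: keep.
  move=> rt; have [lka|lka] := leqP (key t) (key a); first by apply: change => //; left.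
  apply: keep; split=> // k1.
  by have := ltn_trans lka k1; rewrite ltnn.
- by move: vt0; rewrite (H t0) ?mem_enum ?eqxx.
exists t => //; split=> [|t']; first by rewrite divff.
by apply: Ht; rewrite mem_enum.
Qed.

Variables (T : finType) (key : T -> nat) (s : nat) (e : T -> 'rV[L]_s).
Hypothesis key_inj : injective key.

Definition is_leading (t : T) : Prop :=
  exists v : T -> L, \sum_t' v t' *: e t' = 0 /\ leads key v t.

Definition leading : {set T} := [set t | boolp.asbool (is_leading t)].
Definition standard : {set T} := ~: leading.

Lemma standardP t : reflect (~ is_leading t) (t \in standard).
Proof.
rewrite !inE; apply: (iffP idP) => [/negP H /boolp.asboolP //|H].
by apply/negP => /boolp.asboolP.
Qed.

Definition family_mx : 'M[L]_(#|T|, s) := \matrix_i e (enum_val i).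
Definition standard_mx : 'M[L]_(#|standard|, s) := \matrix_i e (enum_val i).

(** A relation between standard rows would have a leading index, and this index
    would be standard. *)
Lemma standard_free : row_free standard_mx.
Proof.
apply: inj_row_free => v Hv; apply/rowP => i0; rewrite mxE.
apply: contraTeq isT => vi0; exfalso.
pose w t := \sum_(i < #|standard|) v 0 i *+ (enum_val i == t).
have w_val i : w (enum_val i) = v 0 i.
  rewrite /w (bigD1 i) //= eqxx big1 ?addr0 // => k ki.
  by rewrite (inj_eq enum_val_inj) (negPf ki).
have w_std t : w t != 0 -> t \in standard.
  apply: contraNT => tn; rewrite /w big1 // => i _.
  by case: eqP => // E; move: tn; rewrite -E enum_valP.
have w_rel : \sum_t w t *: e t = 0.
  rewrite -[RHS]Hv mulmx_sum_row.
  under eq_bigr do rewrite /w scaler_suml.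
  rewrite exchange_big /=; apply: eq_bigr => i _.
  rewrite (bigD1 (enum_val i)) //= eqxx big1 ?addr0 => [|t tn].
    by rewrite rowK.
  by rewrite eq_sym (negPf tn) mulr0n scale0r.
have [t wt lt] : exists2 t, w t != 0 & leads key (fun t' => w t' / w t) t.
  by apply: (@exists_leading _ _ _ (enum_val i0)); rewrite w_val.
have /standardP := w_std _ wt; apply; exists (fun t' => w t' / w t); split=> //.
transitivity ((w t)^-1 *: \sum_t' w t' *: e t'); last by rewrite w_rel scaler0.
rewrite scaler_sumr.
by apply: eq_bigr => t' _; rewrite scalerA mulrC.
Qed.

Lemma rank_standard : \rank standard_mx = #|standard|.
Proof. exact/eqP/standard_free. Qed.

(** Relations with distinct leading indices are linearly independent, so the
    relation space has dimension at least the number of leading indices. *)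
Lemma rank_family_le : (\rank family_mx <= #|standard|)%N.
Proof.
have [f Hf] : exists f : 'I_#|leading| -> T -> L,
    forall i, \sum_t' f i t' *: e t' = 0 /\ leads key (f i) (enum_val i).
  have H (i : 'I_#|leading|) : is_leading (enum_val i).
    by have := enum_valP i; rewrite inE => /boolp.asboolP.
  by have [f Hf] := boolp.choice H; exists f.
pose V := \matrix_(i < #|leading|, j < #|T|) f i (enum_val j).
have VE : V *m family_mx = 0.
  apply/row_matrixP => i; rewrite row_mul row0 mulmx_sum_row.
  rewrite -[RHS](proj1 (Hf i)); transitivity (\sum_(t in T) f i t *: e t).
    by rewrite [RHS]big_enum_val; apply: eq_bigr => j _; rewrite rowK !mxE.
  exact: eq_bigl.
have Vfree : row_free V.
  apply: inj_row_free => w Hw; apply/rowP => i0; rewrite mxE.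
  apply: contraTeq isT => wi0; exfalso.
  have [i wi [_ li]] := @exists_leading _ (fun i => key (enum_val i)) _ _ wi0.
  apply: (@ideal_proper _ P).
  (* Column of the leading term of the dominant coefficient w_i: every other
     product in this column lies in the ideal, so 1 would too. *)
  have /rowP/(_ (enum_rank (enum_val i))) := Hw.
  rewrite !mxE (bigD1 i) //= mxE enum_rankK (proj1 (proj2 (Hf i))) mulr1.
  move/(congr1 (fun x => x / w 0 i)); rewrite mul0r mulrDl divff // big_distrl /=.
  move/eqP; rewrite addr_eq0 => /eqP ->; apply: in_idealN; apply: in_ideal_sum.
  move=> k ki; rewrite mxE enum_rankK mulrAC.
  have [_ lk] := proj2 (Hf k).
  have [rw iw] := li k; have [rf iF] := lk (enum_val i).
  have [lt|gt|eq] := ltngtP (key (enum_val k)) (key (enum_val i)).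
  - by apply: in_idealM => //; apply: iF.
  - by apply: in_idealMr => //; apply: iw.
  - by case/negP: ki; apply/eqP/enum_val_inj/key_inj.
have rV : (#|leading| <= #|T| - \rank family_mx)%N.
  by rewrite -mxrank_ker -(eqP Vfree); apply: mxrankS; apply/sub_kermxP.
rewrite -(leq_add2l #|leading|) cardsC.
by rewrite leq_subRL ?rank_leq_row // addnC in rV.
Qed.

End Leading.

(** Used for the multiplication of monomials by a variable: D is then the diagonal
    matrix of the values of the variable, and relations are carried along f. *)
Lemma is_leading_transfer (L : fieldType) (P : ring_ideal L) (T T' : finType)
  (key : T -> nat) (key' : T' -> nat) s (e : T -> 'rV[L]_s) (e' : T' -> 'rV[L]_s)
  (f : T -> T') (D : 'M[L]_s) (t : T) :
  injective f ->
  (forall x y, (key' (f x) < key' (f y))%N -> (key x < key y)%N) ->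
  (forall x, e' (f x) = e x *m D) ->
  is_leading P key e t -> is_leading P key' e' (f t).
Proof.
move=> finj fkey fe [v [Hv [v1 lv]]].
pose w t' := \sum_x v x *+ (f x == t').
have w_f x : w (f x) = v x.
  rewrite /w (bigD1 x) //= eqxx big1 ?addr0 // => y yx.
  by rewrite (inj_eq finj) (negPf yx).
have w_out t' : (forall x, f x != t') -> w t' = 0.
  by move=> H; rewrite /w big1 // => x _; rewrite (negPf (H x)).
exists w; split.
  transitivity (\sum_x v x *: e' (f x)).
    under eq_bigr do rewrite /w scaler_suml.
    rewrite exchange_big /=; apply: eq_bigr => x _.
    rewrite (bigD1 (f x)) //= eqxx big1 ?addr0 // => y yx.
    by rewrite eq_sym (negPf yx) mulr0n scale0r.
  under eq_bigr do rewrite fe scalemxAl.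
  by rewrite -mulmx_suml Hv mul0mx.
split=> [|t']; first by rewrite w_f.
case: (boolP [exists x, f x == t']) => [/existsP [x /eqP <-]|/existsPn H].
  by rewrite w_f; have [h1 h2] := lv x; split=> // /fkey.
rewrite w_out //.
by split=> [|_]; [exact: in_ring0|exact: in_ideal0].
Qed.

(** * Growth of sets of ternary monomials *)

Section TernaryMonomials.
Local Open Scope nat_scope.

(** Normalized matching for monomials in three variables: with f l the
    multiplication by the variable l and c l its exponent, the divisibility of
    f l x by x gets the weight c' l (f l x).  The weights at y sum to [D.+1], and
    those at x to D + 3. *)
Lemma double_count_le (T T' : finType) (A : {set T}) (A' : {set T'}) D
  (c : 'I_3 -> T -> nat) (c' : 'I_3 -> T' -> nat) (f : 'I_3 -> T -> T') :
  (forall l, injective (f l)) ->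
  (forall l x, x \in A -> c' l (f l x) = (c l x).+1) ->
  (forall x, x \in A -> \sum_l c l x = D) ->
  (forall y, y \in A' -> \sum_l c' l y = D.+1) ->
  (forall y l, y \in A' -> 0 < c' l y -> exists2 x, x \in A & y = f l x) ->
  D.+1 * #|A'| <= (D + 3) * #|A|.
Proof.
move=> finj fc sA sA' down.
rewrite mulnC [leqRHS]mulnC -!sum_nat_const.
have -> : \sum_(y in A') D.+1 = \sum_l \sum_(y in A') c' l y.
  by rewrite exchange_big; apply: eq_bigr => y /sA' ->.
have -> : \sum_(x in A) (D + 3) = \sum_(l : 'I_3) \sum_(x in A) c' l (f l x).
  rewrite exchange_big; apply: eq_bigr => x xA /=.
  under eq_bigr do rewrite fc // -addn1.
  by rewrite big_split /= sA // sum_nat_const card_ord.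
apply: leq_sum => l _.
rewrite -(@big_imset _ _ _ _ _ (f l) _ (c' l)) /=; last by move=> x y _ _; apply: finj.
rewrite (bigID (fun y => 0 < c' l y)) /= [X in _ + X]big1 => [|y /andP [_]]; last first.
  by rewrite lt0n negbK => /eqP.
rewrite addn0; apply: (sub_le_big leqnn (fun x y => leq_addr y x)).
move=> y /andP [yA /down] [//|x xA ->]; exact: imset_f.
Qed.

(** When all multiples are present, no weight is lost at the elements of A. *)
Lemma double_count_ge (T T' : finType) (A : {set T}) (A' : {set T'}) D
  (c : 'I_3 -> T -> nat) (c' : 'I_3 -> T' -> nat) (f : 'I_3 -> T -> T') :
  (forall l, injective (f l)) ->
  (forall l x, x \in A -> c' l (f l x) = (c l x).+1) ->
  (forall x, x \in A -> \sum_l c l x = D) ->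
  (forall y, y \in A' -> \sum_l c' l y = D.+1) ->
  (forall x l, x \in A -> f l x \in A') ->
  (D + 3) * #|A| <= D.+1 * #|A'|.
Proof.
move=> finj fc sA sA' up.
rewrite mulnC [leqRHS]mulnC -!sum_nat_const.
have -> : \sum_(y in A') D.+1 = \sum_l \sum_(y in A') c' l y.
  by rewrite exchange_big; apply: eq_bigr => y /sA' ->.
have -> : \sum_(x in A) (D + 3) = \sum_(l : 'I_3) \sum_(x in A) c' l (f l x).
  rewrite exchange_big; apply: eq_bigr => x xA /=.
  under eq_bigr do rewrite fc // -addn1.
  by rewrite big_split /= sA // sum_nat_const card_ord.
apply: leq_sum => l _.
rewrite -(@big_imset _ _ _ _ _ (f l) _ (c' l)) /=; last by move=> x y _ _; apply: finj.
apply: (sub_le_big leqnn (fun x y => leq_addr y x)).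
by move=> y /imsetP [x xA ->]; apply: up.
Qed.

Section Monomials.
Variable Th : finType.

(** Monomials of degree j in x_0, x_1, x_2, with a label that will stand for a
    monomial in the other variables. *)
Definition tmon (j : nat) : finType :=
  {x : {ffun 'I_3 -> 'I_j.+1} * Th | \sum_l (x.1 l : nat) == j}.

Definition expo j (x : tmon j) (l : 'I_3) : nat := (val x).1 l.
Definition label j (x : tmon j) : Th := (val x).2.

Lemma sum_expo j (x : tmon j) : \sum_l expo x l = j.
Proof. exact/eqP/(valP x). Qed.

Lemma tmon_eq j (x y : tmon j) : expo x =1 expo y -> label x = label y -> x = y.
Proof.
case: x => [[x th] px]; case: y => [[y th'] py]; rewrite /expo /label /=.
move=> exy eth; apply: val_inj => /=; congr (_, _) => //.
by apply/ffunP => l; apply: val_inj; apply: exy.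
Qed.

Fact mk_tmon_proof j (f : 'I_3 -> nat) (th : Th) : \sum_l f l = j ->
  \sum_l ((([ffun l => inord (f l)], th) : {ffun 'I_3 -> 'I_j.+1} * Th).1 l : nat) == j.
Proof.
move=> sf; apply/eqP; rewrite -[RHS]sf; apply: eq_bigr => l _.
by rewrite ffunE inordK // ltnS -sf (bigD1 l) //= leq_addr.
Qed.

Definition mk_tmon j f th (sf : \sum_l f l = j) : tmon j :=
  exist (fun x : {ffun 'I_3 -> 'I_j.+1} * Th => \sum_l (x.1 l : nat) == j)
    ([ffun l => inord (f l)], th) (mk_tmon_proof th sf).

Lemma expo_mk j f th (sf : \sum_l f l = j) : expo (mk_tmon th sf) =1 f.
Proof.
by move=> l; rewrite /expo ffunE inordK // ltnS -sf (bigD1 l) //= leq_addr.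
Qed.

Fact shift_proof j (l : 'I_3) (x : tmon j) : \sum_k (expo x k + (k == l)) = j.+1.
Proof.
rewrite big_split /= sum_expo (bigD1 l) //= eqxx big1 ?addn1 // => k kl.
by rewrite (negPf kl).
Qed.

Definition shift j (l : 'I_3) (x : tmon j) : tmon j.+1 :=
  mk_tmon (label x) (shift_proof l x).

Lemma expo_shift j l (x : tmon j) k : expo (shift l x) k = expo x k + (k == l).
Proof. exact: expo_mk. Qed.

Lemma label_shift j l (x : tmon j) : label (shift l x) = label x.
Proof. by []. Qed.

Lemma shift_inj j l : injective (@shift j l).
Proof.
move=> x y exy; apply: tmon_eq => [k|]; last by rewrite -(label_shift l) exy.
by apply/eqP; rewrite -(eqn_add2r (k == l)) -!expo_shift exy.
Qed.

Lemma unshift j l (y : tmon j.+1) : 0 < expo y l -> exists x, y = shift l x.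
Proof.
move=> yl; have sf : \sum_k (expo y k - (k == l)) = j.
  apply/eqP; rewrite -eqSS -[X in _ == X](sum_expo y) (bigD1 l) //=.
  rewrite [X in _ == X](bigD1 l) //= eqxx -addSn -subSn // subn1 /=.
  rewrite eqn_add2l; apply/eqP/eq_bigr => k kl.
  by rewrite (negPf kl) subn0.
exists (mk_tmon (label y) sf); apply: tmon_eq => // k.
rewrite expo_shift expo_mk; case: (eqVneq k l) => [->|_]; lia.
Qed.

Lemma sum3 (f : 'I_3 -> nat) :
  \sum_l f l = f 0%R + f 1%R + f 2%R.
Proof.
rewrite !big_ord_recl big_ord0 addn0 addnA.
by congr (f _ + f _ + f _); apply: val_inj.
Qed.

Lemma ord3P (l : 'I_3) : [\/ l = 0%R, l = 1%R | l = 2%R].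
Proof.
case: l => [[|[|[|//]]] Hl]; [apply: Or31|apply: Or32|apply: Or33];
  exact: val_inj.
Qed.

Section Counting.
Variable a : 'I_3 -> nat.
Variable j : nat.
Hypothesis jE : j = a 1%R + a 2%R.

Definition box i (x : tmon i) := [forall l, expo x l <= a l].
Definition rect i (x : tmon i) := (expo x 1%R <= a 1%R) && (expo x 2%R <= a 2%R).
(** Outside the box, monomials are split according to the first exponent that is
    too large.  This makes each class stable under division by a variable
    whenever the divisor keeps exponent k above [a k]. *)
Definition excess k i (x : tmon i) :=
  (a k < expo x k) && [forall l : 'I_3, (l < k) ==> (expo x l <= a l)].

Lemma box3 i (x : tmon i) :
  box x = (expo x 0%R <= a 0%R) && rect x.
Proof.
apply/forallP/and3P => [H|[h0 h1 h2] l]; first by split; apply: H.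
by case: (ord3P l) => ->.
Qed.

Lemma excessE i (x : tmon i) :
  [/\ excess 0%R x = (a 0%R < expo x 0%R),
      excess 1%R x = (a 1%R < expo x 1%R) && (expo x 0%R <= a 0%R) &
      excess 2%R x = [&& a 2%R < expo x 2%R, expo x 0%R <= a 0%R & expo x 1%R <= a 1%R]].
Proof.
have E k : [forall l : 'I_3, (l < k) ==> (expo x l <= a l)] =
  [&& (0 < k) ==> (expo x 0%R <= a 0%R), (1 < k) ==> (expo x 1%R <= a 1%R) &
     (2 < k) ==> (expo x 2%R <= a 2%R)].
  apply/forallP/and3P => [H|[h0 h1 h2] l]; last by case: (ord3P l) => ->.
  by split; [have := H 0%R|have := H 1%R|have := H 2%R].
by split; rewrite /excess E /= ?andbT.
Qed.

Lemma box_or_excess i (x : tmon i) :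
  box x + \sum_k excess k x = 1 :> nat.
Proof. have [] := excessE x; rewrite sum3 box3 /rect => -> -> ->; lia. Qed.

Lemma card_box_excess i (A : {set tmon i}) :
  #|A| = #|[set x in A | box x]| + \sum_k #|[set x in A | excess k x]|.
Proof.
have E (p : pred (tmon i)) : #|[set x in A | p x]| = \sum_(x in A) p x.
  rewrite -sum1_card; under eq_bigl do rewrite inE.
  by rewrite big_mkcondr /=; apply: eq_bigr => x _; case: (p x).
rewrite (E (@box i)); under [X in _ = _ + X]eq_bigr do rewrite (E (@excess _ i)).
rewrite exchange_big -big_split /= -sum1_card; apply: eq_bigr => x _.
by rewrite box_or_excess.
Qed.

Lemma card_rect : (a 1%R).+1 * (a 2%R).+1 * #|Th| <= #|[set x : tmon j | rect x]|.
Proof.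
pose f (t : 'I_(a 1%R).+1 * 'I_(a 2%R).+1 * Th) (l : 'I_3) : nat :=
  nth 0 [:: j - t.1.1 - t.1.2; t.1.1 : nat; t.1.2 : nat] l.
have sf t : \sum_l f t l = j.
  rewrite sum3 /f /=; have := ltn_ord t.1.1; have := ltn_ord t.1.2; lia.
pose g t := mk_tmon t.2 (sf t).
have gE t l : expo (g t) l = f t l by exact: expo_mk.
have ginj : injective g.
  move=> t t' gt; have e1 : f t 1%R = f t' 1%R by rewrite -!gE gt.
  have e2 : f t 2%R = f t' 2%R by rewrite -!gE gt.
  have e3 : t.2 = t'.2 := congr1 (@label j) gt.
  move: e1 e2 e3; rewrite /f /=; case: t {gt} => [[p q] th]; case: t' => [[p' q'] th'] /=.
  by move=> /val_inj -> /val_inj -> ->.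
apply: leq_trans (_ : #|[set g t | t in predT]| <= _).
  by rewrite card_imset // !card_prod !card_ord.
apply/subset_leq_card/subsetP => _ /imsetP [t _ ->]; rewrite inE /rect !gE.
by apply/andP; split; rewrite -ltnS; apply: ltn_ord.
Qed.

(** In degree [j.+1] the rectangle forces a positive exponent of x_0, which can be
    removed. *)
Lemma card_rectS : #|[set x : tmon j.+1 | rect x]| <= #|[set x : tmon j | rect x]|.
Proof.
rewrite -(card_imset _ (@shift_inj j 0%R)).
apply/subset_leq_card/subsetP => y; rewrite inE => /andP [y1 y2].
have [|x Ex] := @unshift j 0%R y.
  by have := sum_expo y; rewrite sum3; lia.
apply/imsetP; exists x => //; rewrite inE /rect.
by move: y1 y2; rewrite Ex !expo_shift /= !addn0 => -> ->.
Qed.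

(** Exponents of the quotient by the power of x_k with exponent [(a k).+1]. *)
Definition cofactor k n l (x : tmon n) :=
  if l == k then expo x l - (a k).+1 else expo x l.

Lemma sum_cofactor k n (x : tmon n) :
  a k < expo x k -> \sum_l cofactor k l x = n - (a k).+1.
Proof.
move=> h; rewrite -[in RHS](sum_expo x) (bigD1 k) //= [in RHS](bigD1 k) //=.
rewrite /cofactor eqxx -addnBAC //; congr (_ + _).
by apply: eq_bigr => l /negPf ->.
Qed.

Lemma cofactor_shift k n l (x : tmon n) :
  a k < expo x k -> cofactor k l (shift l x) = (cofactor k l x).+1.
Proof.
by rewrite /cofactor expo_shift eqxx; case: (eqVneq l k) => [->|_]; lia.
Qed.

Section Growth.
Hypotheses (a10 : a 1%R <= a 0%R) (a21 : a 2%R <= a 1%R).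
Hypothesis a0_small : a 0%R < j.
Let i := j - (a 0%R).+1.
Let big_x0 n : {set tmon n} := [set x | a 0%R < expo x 0%R].

(** What remains of the degree after x_0 is at most a_2, as a_1 <= a_0. *)
Lemma rect_big_x0 n (x : tmon n) : n <= j.+1 -> a 0%R < expo x 0%R -> rect x.
Proof.
by move=> nj; have := sum_expo x; move: nj; rewrite sum3 /rect; lia.
Qed.

(** These monomials are all the multiples of a power of x_0, so they behave like
    the full sets of monomials of degrees i and i + 1. *)
Lemma card_big_x0 : (i + 3) * #|big_x0 j| <= i.+1 * #|big_x0 j.+1|.
Proof.
apply: (@double_count_ge _ _ _ _ _ (@cofactor 0%R j) (@cofactor 0%R j.+1) (@shift j)).
- exact: shift_inj.
- by move=> l x; rewrite inE; apply: cofactor_shift.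
- by move=> x; rewrite inE => /sum_cofactor.
- by move=> x; rewrite inE => /sum_cofactor ->; rewrite subSn.
- by move=> x l; rewrite !inE expo_shift; lia.
Qed.

Variables (A : {set tmon j}) (A' : {set tmon j.+1}).
Hypothesis down : forall l x, shift l x \in A' -> x \in A.

(** A class of excess k consists of multiples of x_k to the power [(a k).+1].  The
    cofactors have degree D = j - (a k).+1 >= i, and the growth rate
    (D + 3) / (D + 1) decreases with D. *)
Lemma card_excess_growth k :
  i.+1 * #|[set x in A' | excess k x]| <= (i + 3) * #|[set x in A | excess k x]|.
Proof.
set Q := [set x in A | _]; set Q' := [set x in A' | _].
have ak : a k <= a 0%R by case: (ord3P k) => ->; lia.
pose D := j - (a k).+1.
have : D.+1 * #|Q'| <= (D + 3) * #|Q|.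
  apply: (@double_count_le _ _ _ _ _ (@cofactor k j) (@cofactor k j.+1) (@shift j)).
  - exact: shift_inj.
  - by move=> l x; rewrite !inE => /and3P [_ h _]; apply: cofactor_shift.
  - by move=> x; rewrite !inE => /and3P [_ /sum_cofactor h _].
  - by move=> x; rewrite !inE => /and3P [_ /sum_cofactor -> _]; rewrite subSn //; lia.
  move=> y l; rewrite !inE /cofactor => /and3P [yA yk /forallP yl] cy.
  have [|x Ex] := @unshift j l y; first by move: cy; case: eqP; lia.
  exists x => //; rewrite !inE (@down l) -?Ex //=; apply/andP; split.
    by move: yk cy; rewrite Ex !expo_shift; case: (eqVneq l k) => [->|_]; rewrite ?eqxx; lia.
  apply/forallP => m; apply/implyP => mk; have /implyP/(_ mk) := yl m.
  by rewrite Ex expo_shift; apply: leq_trans; exact: leq_addr.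
have : i <= D by rewrite /i /D; lia.
move: (i) (D) #|Q'| #|Q| => n m q' q nm H.
have [le|lt] := leqP q' q; nia.
Qed.

Hypothesis boxA : forall x, box x -> x \in A.
Hypothesis leAA' : #|A| <= #|A'|.

(** With N the number of monomials in the rectangle, fewer than N elements in A
    leave fewer excess monomials than [big_x0] has, and [leAA'] makes their number
    grow by at least as much; both have growth rate governed by
    (i + 3) / (i + 1), so this is impossible. *)
Lemma card_growth_lower : (a 1%R).+1 * (a 2%R).+1 * #|Th| <= #|A|.
Proof.
rewrite leqNgt; apply/negP => ltA.
have cb n : n <= j.+1 -> #|[set x : tmon n | box x]| + #|big_x0 n| = #|[set x : tmon n | rect x]|.
  move=> nj; rewrite -(cardsID (big_x0 n) [set x | rect x]) addnC.
  congr (_ + _); apply: eq_card => x.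
    by rewrite !inE andb_idl // => /(rect_big_x0 nj).
  by rewrite !inE box3 -leqNgt.
have A1 := card_box_excess A; have A2 := card_box_excess A'.
have b1 : #|[set x in A | box x]| = #|[set x : tmon j | box x]|.
  by apply: eq_card => x; rewrite !inE andb_idl // => /boxA.
have b2 : #|[set x in A' | box x]| <= #|[set x : tmon j.+1 | box x]|.
  by apply/subset_leq_card/subsetP => x; rewrite !inE => /andP [].
have c1 := cb j (leqnSn j); have c2 := cb j.+1 (leqnn _).
have g : i.+1 * \sum_k #|[set x in A' | excess k x]| <=
   (i + 3) * \sum_k #|[set x in A | excess k x]|.
  by rewrite !big_distrr /=; apply: leq_sum => k _; apply: card_excess_growth.
have r := card_big_x0; have p1 := card_rect; have p2 := card_rectS.
move: A1 A2 b1 b2 c1 c2 g r p1 p2 ltA leAA'.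
move: #|[set x in A | box x]| #|[set x in A' | box x]| #|A| #|A'|.
move: #|[set x : tmon j | box x]| #|[set x : tmon j.+1 | box x]|.
move: #|[set x : tmon j | rect x]| #|[set x : tmon j.+1 | rect x]|.
move: #|big_x0 j| #|big_x0 j.+1| (\sum_k _) (\sum_k _) i.
move: ((a 1%R).+1 * (a 2%R).+1 * #|Th|) => N r r' q' q m p p' b b' ab ab' cA cA'.
move=> -> -> -> H1 H2 H3 H4 H5 H6 H7 H8 H9.
 have K1 : q + r' <= q' + r by lia.
have K2 : q < r by lia.
nia.
Qed.

End Growth.
End Counting.
End Monomials.

End TernaryMonomials.

(** * The number of points of a degenerating linear combination *)

Lemma divn_eq_inj d m m' r r' : (r < d)%N -> (r' < d)%N ->
  (m * d + r = m' * d + r')%N -> m = m' /\ r = r'.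
Proof.
move=> rd rd' E; have d0 : (0 < d)%N by apply: leq_trans rd.
split; first by have := congr1 (divn^~ d) E; rewrite !divnMDl // !divn_small // !addn0.
by have := congr1 (modn^~ d) E; rewrite !modnMDl !modn_small.
Qed.

Section Key.
Variables (Th : finType) (B : nat).

(** A lexicographic order encoded in base B.  The common base makes
    multiplication by a variable translate the keys. *)
Definition mon_key j (x : tmon Th j) : nat :=
  (expo x 0 * B + expo x 1) * #|Th| + enum_rank (label x).

Lemma expo_le j (x : tmon Th j) l : (expo x l <= j)%N.
Proof. by rewrite -[leqRHS](sum_expo x) (bigD1 l) //= leq_addr. Qed.

Lemma mon_key_inj j : (j < B)%N -> injective (@mon_key j).
Proof.
move=> jB x y E; have eB (z : tmon Th j) l : (expo z l < B)%N.
  exact: leq_ltn_trans (expo_le z l) jB.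
have [E1 /val_inj/enum_rank_inj e2] := divn_eq_inj (ltn_ord _) (ltn_ord _) E.
have [e0 e1] := divn_eq_inj (eB x _) (eB y _) E1.
apply: tmon_eq => // l; case: (ord3P l) => -> //.
by have := sum_expo x; have := sum_expo y; rewrite !sum3 -e0 -e1; lia.
Qed.

Lemma mon_key_shift j l (x y : tmon Th j) :
  (mon_key (shift l x) < mon_key (shift l y))%N -> (mon_key x < mon_key y)%N.
Proof.
have E z : mon_key (shift l z) = (mon_key z + ((0 == l) * B + (1 == l)) * #|Th|)%N.
  rewrite /mon_key !expo_shift label_shift.
  have ar (p q r m n N : nat) :
    (((p + m) * B + (q + n)) * N + r = (p * B + q) * N + r + (m * B + n) * N)%N.
    by rewrite !mulnDl; lia.
  exact: ar.
by rewrite !E ltn_add2r.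
Qed.
End Key.

Section Core.
Variables (L : fieldType) (P : ring_ideal L).
Hypothesis valV : forall x, in_ring P x \/ in_ideal P x^-1.
Variables (Th : finType) (s : nat).
Variables (c : 'I_s -> L) (u : 'I_s -> 'I_3 -> L) (Y Y' : Th -> 'I_s -> L).
Variable a : 'I_3 -> nat.

Definition ev_row j (x : tmon Th j) : 'rV[L]_s :=
  \row_t ((\prod_l u t l ^+ expo x l) * Y (label x) t).

Lemma ev_row_shift j l (x : tmon Th j) :
  ev_row (shift l x) = ev_row x *m diag_mx (\row_t u t l).
Proof.
apply/rowP => t; rewrite mul_mx_diag !mxE mulrAC; congr (_ * _).
rewrite (bigD1 l) //= [in RHS](bigD1 l) //= expo_shift eqxx addn1 exprSr mulrAC.
by congr (_ * _); apply: eq_bigr => k /negPf kl; rewrite expo_shift kl addn0.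
Qed.

Hypothesis u0 : forall t, u t 0 != 0.
(* The weighted evaluation at the points reduces, modulo the ideal, to the
   functional dual to one monomial. *)
Hypothesis near_dual : forall (z : 'I_3 -> nat) th th', (\sum_l z l = \sum_l a l)%N ->
  in_ideal P (\sum_t c t * (\prod_l u t l ^+ z l) * Y th t * Y' th' t
     - ([forall l, z l == a l] && (th == th'))%:R).

(** Multiplying a relation led by x by the monomial with exponents
    [a l - expo x l] and applying the weighted evaluation leaves, modulo the
    ideal, the coefficient of x, which is 1. *)
Lemma box_standard j (key : tmon Th j -> nat) (x : tmon Th j) :
  box a x -> x \in standard P key (@ev_row j).
Proof.
move=> /forallP bx; apply/standardP => -[v [Hv [v1 lv]]].
apply: (@ideal_proper _ P).
pose z (y : tmon Th j) l := (expo y l + (a l - expo x l))%N.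
have sz y : (\sum_l z y l = \sum_l a l)%N.
  rewrite big_split /= sum_expo.
  transitivity (\sum_l expo x l + \sum_l (a l - expo x l))%N; first by rewrite sum_expo.
  rewrite -big_split /=.
  by apply: eq_bigr => l _; rewrite subnKC.
pose G y := \sum_t c t * (\prod_l u t l ^+ z y l) * Y (label y) t * Y' (label x) t.
have G0 : \sum_y v y * G y = 0.
  under eq_bigr do rewrite big_distrr /=.
  rewrite exchange_big big1 //= => t _.
  have /rowP/(_ t) := Hv; rewrite summxE mxE => Ht.
  rewrite -[RHS](mulr0 (c t * Y' (label x) t * \prod_l u t l ^+ (a l - expo x l))).
  rewrite -[X in _ = _ * X]Ht big_distrr /=; apply: eq_bigr => y _; rewrite !mxE.
  under eq_bigr do rewrite exprD.
  rewrite big_split /=.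
  by ring.
rewrite -[X in in_ideal P X]addr0 -oppr0 -G0 (bigD1 x) //= v1 mul1r opprD addrA.
apply: in_idealB.
  rewrite -opprB; apply: in_idealN.
  have := near_dual (label x) (label x) (sz x); rewrite eqxx andbT.
  suff -> : [forall l, z x l == a l] by [].
  by apply/forallP => l; rewrite /z subnKC.
apply: in_ideal_sum => y yx; have [ry _] := lv y; apply: in_idealM => //.
have := near_dual (label y) (label x) (sz y).
suff -> : [forall l, z y l == a l] && (label y == label x) = false by rewrite subr0.
apply: contraNF yx => /andP [/forallP e /eqP el]; apply/eqP/tmon_eq => // l.
by have := e l; have := bx l; rewrite /z; lia.
Qed.

(** A relation led by x, multiplied by the variable l, is led by its shift. *)
Lemma standard_down j (B : nat) l (x : tmon Th j) :
  shift l x \in standard P (@mon_key Th B j.+1) (@ev_row j.+1) ->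
  x \in standard P (@mon_key Th B j) (@ev_row j).
Proof.
move=> /standardP H; apply/standardP => H'; apply: H.
apply: is_leading_transfer H'; [exact: shift_inj|exact: mon_key_shift|].
exact: ev_row_shift.
Qed.

Lemma card_standard_le j B :
  (#|standard P (@mon_key Th B j) (@ev_row j)| <= s)%N.
Proof.
by rewrite -(rank_standard valV) rank_leq_col.
Qed.

(** Multiplication of the rows by x_0 is invertible, as [u t 0 != 0], and embeds
    the evaluations of degree j in those of degree [j.+1]. *)
Lemma card_standardS j B : (j.+1 < B)%N ->
  (#|standard P (@mon_key Th B j) (@ev_row j)| <=
   #|standard P (@mon_key Th B j.+1) (@ev_row j.+1)|)%N.
Proof.
move=> jB; rewrite -(rank_standard valV).
apply: leq_trans (rank_family_le valV _ (mon_key_inj jB)).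
have Dunit : row_free (diag_mx (\row_t u t 0)).
  rewrite row_free_unit unitmxE det_diag unitfE; apply/prodf_neq0 => t _.
  by rewrite mxE.
rewrite -(mxrankMfree _ Dunit); apply: mxrankS; apply/row_subP => i.
rewrite row_mul rowK -ev_row_shift.
suff -> : ev_row (shift 0 (enum_val i)) =
    row (enum_rank (shift 0 (enum_val i))) (family_mx (@ev_row j.+1)) by exact: row_sub.
by rewrite rowK enum_rankK.
Qed.

Hypotheses (a10 : (a 1%R <= a 0%R)%N) (a21 : (a 2%R <= a 1%R)%N).

Theorem number_of_points : ((a 1%R).+1 * (a 2%R).+1 * #|Th| <= s)%N.
Proof.
pose j := (a 1%R + a 2%R)%N.
pose A n := standard P (@mon_key Th j.+2 n) (@ev_row n).
apply: (leq_trans _ (card_standard_le j j.+2)).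
have [small|large] := ltnP (a 0%R) j.
  apply: (@card_growth_lower _ a j erefl a10 a21 small (A j) (A j.+1)).
  - by move=> l x; apply: standard_down.
  - by move=> x; apply: box_standard.
  - exact: card_standardS.
apply: (leq_trans (@card_rect Th a j erefl)).
apply/subset_leq_card/subsetP => x; rewrite inE => rx; apply: box_standard.
rewrite box3 rx andbT; exact: leq_trans (expo_le x _) large.
Qed.

End Core.

(** * Monomials and coefficients in the Cox ring *)

Section Variables.
Variable n : nat.

Lemma big_nvars (R : Type) (idx : R) (op : Monoid.com_law idx) (F : 'I_(nvars n) -> R) :
  \big[op/idx]_(k < nvars n) F k =
  op (\big[op/idx]_(j < 3) F (xvar n j))
     (\big[op/idx]_(i < n) \big[op/idx]_(j < 2) F (yvar i j)).
Proof.
rewrite big_split_ord /=; congr (op _ _).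
rewrite (reindex _ (curry_mxvec_bij _ _)) /= [RHS]pair_big /=.
by apply: eq_bigr => -[i j].
Qed.

Definition mk_mnm (fx : 'I_3 -> nat) (fy : 'I_n -> 'I_2 -> nat) : 'X_{1..(nvars n)} :=
  [multinom (row_mx (\row_j fx j) (mxvec (\matrix_(i, j) fy i j)) : 'rV[nat]_(nvars n)) ord0 k
     | k < nvars n].

Lemma mk_mnm_x fx fy j : mk_mnm fx fy (xvar n j) = fx j.
Proof. by rewrite mnmE row_mxEl mxE. Qed.

Lemma mk_mnm_y fx fy i j : mk_mnm fx fy (yvar i j) = fy i j.
Proof. by rewrite mnmE row_mxEr mxvecE mxE. Qed.

Lemma mnm_xyP (m m' : 'X_{1..(nvars n)}) :
  (forall j, m (xvar n j) = m' (xvar n j)) ->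
  (forall i j, m (yvar i j) = m' (yvar i j)) -> m = m'.
Proof.
move=> ex ey; apply/mnmP => k; rewrite -(splitK k).
case: (split k) => [j|q] /=; first exact: ex.
by case/mxvec_indexP: q => i j; apply: ey.
Qed.

Lemma mdeg_multidegree d1 d (m : 'X_{1..(nvars n)}) :
  has_multidegree d1 d m -> mdeg m = (d1 + \sum_i d i)%N.
Proof.
case/andP => /eqP <- /forallP H; rewrite mdegE big_nvars; congr (_ + _)%N.
by apply: eq_bigr => i _; apply/eqP.
Qed.

Definition mon_val (A : comPzRingType) (u : 'I_3 -> A) (v : 'I_n -> 'I_2 -> A)
    (m : 'X_{1..(nvars n)}) : A :=
  (\prod_j u j ^+ m (xvar n j)) * \prod_i \prod_j v i j ^+ m (yvar i j).

Lemma mon_valD (A : comPzRingType) u v (m m' : 'X_{1..(nvars n)}) :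
  @mon_val A u v (m + m')%MM = mon_val u v m * mon_val u v m'.
Proof.
rewrite /mon_val mulrACA -!big_split /=; congr (_ * _).
  by apply: eq_bigr => j _; rewrite mnmDE exprD.
apply: eq_bigr => i _; rewrite -big_split; apply: eq_bigr => j _.
by rewrite mnmDE exprD.
Qed.

Lemma mon_val0 (A : comPzRingType) u v : @mon_val A u v 0%MM = 1.
Proof.
rewrite /mon_val big1 => [|j _]; last by rewrite mnm0E expr0.
rewrite mul1r big1 // => i _; rewrite big1 // => j _.
by rewrite mnm0E expr0.
Qed.

Lemma mon_val_rmorph (A B : comPzRingType) (f : {rmorphism A -> B}) u v m :
  f (@mon_val A u v m) = mon_val (f \o u) (fun i => f \o v i) m.
Proof.
rewrite rmorphM !rmorph_prod; congr (_ * _).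
  by apply: eq_bigr => j _; rewrite rmorphXn.
apply: eq_bigr => i _; rewrite rmorph_prod; apply: eq_bigr => j _.
by rewrite rmorphXn.
Qed.

End Variables.

Section Scaling.
Variables (n : nat) (K : comNzRingType) (W : 'X_{1..n} -> K).
Hypotheses (W0 : W 0%MM = 1) (WD : forall m m', W (m + m')%MM = W m * W m').
Implicit Types p q : {mpoly K[n]}.

(** For W the value of monomials at a point w, this relates a form evaluated on
    the variables w_k X_k to the form itself; unlike substitution, it needs only
    to be checked on coefficients. *)
Definition scaled p q := forall m, p@_m = W m * q@_m.

Lemma scaledM p p' q q' : scaled p q -> scaled p' q' -> scaled (p * p') (q * q').
Proof.
move=> h h' m; rewrite !mcoeffM big_distrr /=; apply: eq_bigr => k /eqP mk.
by rewrite h h' mulrACA -WD -mk.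
Qed.

Lemma scaled1 : scaled 1 1.
Proof.
by move=> m; rewrite !mcoeff1; case: eqP => [->|_]; rewrite ?W0 ?mulr1 ?mulr0.
Qed.

Lemma scaledX p q k : scaled p q -> scaled (p ^+ k) (q ^+ k).
Proof.
move=> h; elim: k => [|k IH]; first by rewrite !expr0; exact: scaled1.
by rewrite !exprS; apply: scaledM.
Qed.

Lemma scaled_prod (I : finType) (p q : I -> {mpoly K[n]}) :
  (forall i, scaled (p i) (q i)) -> scaled (\prod_i p i) (\prod_i q i).
Proof.
by move=> h; apply: big_ind2 => [|p1 q1 p2 q2|//]; [exact: scaled1|exact: scaledM].
Qed.

Lemma scaled_linear k (g : 'I_k -> 'I_n) (b : 'I_k -> K) :
  (forall j, W U_(g j)%MM = b j) ->
  scaled (\sum_(j < k) b j *: 'X_(g j)) (\sum_(j < k) 1 *: 'X_(g j)).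
Proof.
move=> Wb m; rewrite !raddf_sum /= big_distrr; apply: eq_bigr => j _ /=.
rewrite !mcoeffZ !mcoeffX mul1r; case: eqP => [<-|_]; last by rewrite !mulr0.
by rewrite Wb.
Qed.

End Scaling.

Section Positive.
Variables (n : nat) (K : numFieldType).
Implicit Types p q : {mpoly K[n]}.

(** Nonnegativity of all coefficients prevents cancellation, so that positivity of
    one coefficient passes to products. *)
Definition nonneg_pos_at p (m : 'X_{1..n}) :=
  (forall m', 0 <= p@_m') /\ 0 < p@_m.

Lemma nonneg_pos_atM p q m m' : nonneg_pos_at p m -> nonneg_pos_at q m' ->
  nonneg_pos_at (p * q) (m + m')%MM.
Proof.
move=> [p0 pm] [q0 qm]; split=> [m2|]; rewrite mcoeffM.
  by apply: sumr_ge0 => k _; apply: mulr_ge0.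
have hm : (mdeg m < (mdeg (m + m')%MM).+1)%N by rewrite ltnS mdegD leq_addr.
have hm' : (mdeg m' < (mdeg (m + m')%MM).+1)%N by rewrite ltnS mdegD leq_addl.
rewrite (bigD1 (BMultinom hm, BMultinom hm')) //=.
rewrite ltr_pwDl ?mulr_gt0 //; apply: sumr_ge0 => k _; exact: mulr_ge0.
Qed.

Lemma nonneg_pos_at1 : nonneg_pos_at 1 0%MM.
Proof.
by split=> [m|]; rewrite mcoeff1 ?eqxx ?ltr01 // ler0n.
Qed.

Lemma nonneg_pos_at_prod (I : finType) (p : I -> {mpoly K[n]}) (m : I -> 'X_{1..n}) :
  (forall i, nonneg_pos_at (p i) (m i)) ->
  nonneg_pos_at (\prod_i p i) (\sum_i m i)%MM.
Proof.
move=> h; apply: (big_ind2 nonneg_pos_at) => [|p1 q1 p2 q2|//].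
  exact: nonneg_pos_at1.
exact: nonneg_pos_atM.
Qed.

Lemma nonneg_pos_at_power k (g : 'I_k -> 'I_n) (e : 'I_k -> nat) r :
  (\sum_j e j = r)%N ->
  nonneg_pos_at ((\sum_(j < k) 1 *: 'X_(g j)) ^+ r) (\sum_j U_(g j) *+ e j)%MM.
Proof.
elim: r e => [|r IH] e se.
  rewrite expr0 big1 => [|j _]; first exact: nonneg_pos_at1.
  move/eqP: se; rewrite sum_nat_eq0 => /forallP /(_ j) /eqP ->.
  exact: mulm0n.
have [j0 ej0] : exists j, e j != 0%N.
  apply/existsP; rewrite -negb_forall; apply: contra_eqN se => /forallP e0.
  by rewrite big1 // => j _; apply/eqP; have := e0 j.
pose e' j := (e j - (j == j0))%N.
have se' : (\sum_j e' j = r)%N.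
  move: se; rewrite (bigD1 j0) //= [in X in _ -> X](bigD1 j0) //= {1}/e' eqxx.
  have -> : (\sum_(i < k | i != j0) e' i = \sum_(i < k | i != j0) e i)%N.
    by apply: eq_bigr => j /negPf; rewrite /e' => ->; rewrite subn0.
  by move: ej0; case: (e j0) => // q _; rewrite subn1 addSn => -[].
have -> : (\sum_j U_(g j) *+ e j = U_(g j0) + \sum_j U_(g j) *+ e' j)%MM.
  rewrite (bigD1 j0) //= [in RHS](bigD1 j0) //= addmA; congr (_ + _)%MM.
    by rewrite /e' eqxx -mulmS subn1 prednK // lt0n.
  by apply: eq_bigr => j /negPf; rewrite /e' => ->; rewrite subn0.
rewrite exprS; apply: nonneg_pos_atM; last exact: IH.
split=> [m|]; rewrite raddf_sum /=.
  by apply: sumr_ge0 => j _; rewrite mcoeffZ mcoeffX mul1r ler0n.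
rewrite (bigD1 j0) //= mcoeffZ mcoeffX mul1r eqxx ltr_pwDl ?ltr01 //.
by apply: sumr_ge0 => j _; rewrite mcoeffZ mcoeffX mul1r ler0n.
Qed.
End Positive.

Lemma xform_const1 (K : fieldType) n :
  xform n (const_mx 1) = \sum_(j < 3) 1 *: 'X_(xvar n j) :> {mpoly K[nvars n]}.
Proof. by apply: eq_bigr => j _; rewrite mxE. Qed.

Lemma yform_const1 (K : fieldType) n (i : 'I_n) :
  yform i (const_mx 1) = \sum_(j < 2) 1 *: 'X_(yvar i j) :> {mpoly K[nvars n]}.
Proof. by apply: eq_bigr => j _; rewrite mxE. Qed.

Section SegreCoefficients.
Variables (K : numFieldType) (n d1 : nat) (d : 'I_n -> nat).

(** The product of the multinomial coefficients attached to m, obtained as the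
    coefficient of the point whose vectors have all entries 1. *)
Definition segre_coef (m : 'X_{1..(nvars n)}) : K :=
  (segre_veronese d1 d (const_mx 1) (fun=> const_mx 1))@_m.

Lemma mcoeff_segre u v m :
  (@segre_veronese K n d1 d u v)@_m = segre_coef m * mon_val (u 0) (fun i => v i 0) m.
Proof.
pose W := mon_val (u 0) (fun i => v i 0).
have W0 : W 0%MM = 1 by exact: mon_val0.
have WD m1 m2 : W (m1 + m2)%MM = W m1 * W m2 by exact: mon_valD.
rewrite mulrC -/(W m); move: m; rewrite -/(scaled W _ _) /segre_veronese.
have xn j k : (xvar n j == xvar n k) = (j == k) by rewrite (inj_eq (@lshift_inj _ _)).
have yn i j (i' : 'I_n) j' : (yvar i j == yvar i' j') = ((i, j) == (i', j')).
  rewrite (inj_eq (@rshift_inj _ _)); apply/eqP/eqP => [|[-> ->] //].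
  by move/cast_ord_inj/enum_rank_inj.
have xy j i j' : (xvar n j == yvar i j') = false by rewrite eq_lrshift.
have yx j i j' : (yvar i j' == xvar n j) = false by rewrite eq_rlshift.
apply: scaledM => //.
  apply: scaledX => //; rewrite xform_const1.
  apply: scaled_linear => j; rewrite /W /mon_val (bigD1 j) //= mnm1E eqxx expr1.
  rewrite big1 => [|k kj]; last by rewrite mnm1E xn eq_sym (negPf kj).
  rewrite mulr1 big1 ?mulr1 // => i _; rewrite big1 // => k _.
  by rewrite mnm1E xy.
apply: scaled_prod => // i; apply: scaledX => //; rewrite yform_const1.
apply: scaled_linear => j; rewrite /W /mon_val big1 => [|k _]; last by rewrite mnm1E yx.
rewrite mul1r (bigD1 i) //= [X in _ * X]big1 => [|k ki]; last first.
  by rewrite big1 // => l _; rewrite mnm1E yn xpair_eqE eq_sym (negPf ki).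
rewrite mulr1 (bigD1 j) //= mnm1E eqxx expr1 big1 ?mulr1 // => k kj.
by rewrite mnm1E yn xpair_eqE eqxx /= eq_sym (negPf kj).
Qed.

Lemma segre_coef_neq0 m : has_multidegree d1 d m -> segre_coef m != 0.
Proof.
case/andP => /eqP mx /forallP my; apply: lt0r_neq0.
suff [_] : nonneg_pos_at (segre_veronese d1 d (const_mx 1) (fun=> const_mx 1) : {mpoly K[_]}) m.
  by [].
have -> : m = ((\sum_j U_(xvar n j) *+ m (xvar n j)) +
    \sum_i \sum_j U_(yvar i j) *+ m (yvar i j))%MM.
  by rewrite {1}[m]multinomUE_id big_nvars.
rewrite /segre_veronese xform_const1.
apply: nonneg_pos_atM; first exact: nonneg_pos_at_power.
apply: nonneg_pos_at_prod => i; rewrite yform_const1.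
by apply: nonneg_pos_at_power; apply/eqP.
Qed.

End SegreCoefficients.

Section MonomialTensor.
Variables (K : fieldType) (n a0 a1 a2 : nat) (b0 b1 : 'I_n -> nat).

Definition tensor_mnm : 'X_{1..(nvars n)} :=
  mk_mnm (fun j => nth 0%N [:: a0; a1; a2] j) (fun i j => nth 0%N [:: b0 i; b1 i] j).

Lemma monomial_tensorE : monomial_tensor K a0 a1 a2 b0 b1 = 'X_[tensor_mnm].
Proof.
rewrite /monomial_tensor [RHS]mpolyXE_id big_nvars /=; congr (_ * _).
  rewrite !big_ord_recl big_ord0 mulr1 mulrA !mk_mnm_x /=.
  by congr ('X_(xvar n _) ^+ _ * 'X_(xvar n _) ^+ _ * 'X_(xvar n _) ^+ _); apply: val_inj.
apply: eq_bigr => i _; rewrite !big_ord_recl big_ord0 mulr1 !mk_mnm_y /=.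
by congr ('X_(yvar i _) ^+ _ * 'X_(yvar i _) ^+ _); apply: val_inj.
Qed.

Lemma tensor_mnm_multidegree d1 d : (a0 + a1 + a2)%N = d1 ->
  (forall i, b0 i + b1 i = d i)%N -> has_multidegree d1 d tensor_mnm.
Proof.
move=> <- hb; apply/andP; split; last apply/forallP => i.
  by rewrite !big_ord_recl big_ord0 addn0 addnA !mk_mnm_x.
by rewrite !big_ord_recl big_ord0 addn0 !mk_mnm_y /= hb.
Qed.
End MonomialTensor.

(** * The generic point of the secant variety and the lower bound *)

Lemma poly_eq0_nat (K : numFieldType) (p : {poly K}) :
  (forall k : nat, p.[k.+1%:R] = 0) -> p = 0.
Proof.
move=> H; have [//|p0] := eqVneq p 0.
pose rs := [seq k.+1%:R : K | k <- iota 0 (size p)].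
have rs_roots : all (root p) rs by apply/allP => _ /mapP [k _ ->]; apply/rootP.
have rs_uniq : uniq rs.
  rewrite map_inj_uniq ?iota_uniq // => i j /eqP; rewrite eqr_nat => /eqP.
  by case.
by have := max_poly_roots p0 rs_roots rs_uniq; rewrite size_map size_iota ltnn.
Qed.

Section Homogeneous.
Variables (K : numFieldType) (N : nat).
Implicit Types (p : {mpoly K[N]}) (x : 'I_N -> K).

Lemma meval_homog_scale e p x (c : K) : p \is e.-homog ->
  p.@[fun i => c * x i] = c ^+ e * p.@[x].
Proof.
move=> /dhomogP hp; rewrite !mevalE big_distrr /= !big_seq; apply: eq_bigr => m mp.
under eq_bigr do rewrite exprMn.
rewrite big_split /= mulrCA; congr (_ * (_ * _)).
by rewrite prodrXr -mdegE; have := hp _ mp => /= ->.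
Qed.

(** The value at c x is a polynomial in c whose coefficients are the values at x
    of the homogeneous parts. *)
Lemma homog_part_vanishes p x e : (forall c, p.@[fun i => c * x i] = 0) ->
  (pihomog mdeg e p).@[x] = 0.
Proof.
move=> H; pose k := maxn (msize p) e.+1.
pose q : {poly K} := \poly_(e' < k) (pihomog mdeg e' p).@[x].
suff q0 : q = 0.
  by have := congr1 (fun r : {poly K} => r`_e) q0; rewrite coef_poly coef0 leq_maxr.
apply: poly_eq0_nat => c; rewrite horner_poly -[RHS](H c.+1%:R).
rewrite [X in _ = X.@[_]](@pihomog_partitionE _ _ mdeg k) ?leq_maxl //.
rewrite raddf_sum /=; apply: eq_bigr => i _.
by rewrite (@meval_homog_scale i) ?pihomogP // mulrC.
Qed.
End Homogeneous.

Section LowerBound.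
Variables (K : numFieldType) (n d1 : nat) (d : 'I_n -> nat) (s : nat).
Local Notation mons := (basis_mnm d1 d).
Local Notation coordsF := (@coords K n d1 d).

(** One weight, three x-coordinates and 2n y-coordinates for each point. *)
Definition param : finType := ('I_s * (unit + 'I_3 + 'I_n * 'I_2))%type.
Local Notation A := {mpoly K[#|param|]}.
Local Notation L := {fraction A}.

Definition pvar (t : 'I_s) (k : unit + 'I_3 + 'I_n * 'I_2) : A := 'X_(enum_rank (t, k)).
Definition pc t : A := pvar t (inl (inl tt)).
Definition px t j : A := pvar t (inl (inr j)).
Definition py t i j : A := pvar t (inr (i, j)).

Definition generic_coord (m : 'X_{1..(nvars n)}) : A :=
  (segre_coef K d1 d m)%:MP * \sum_t pc t * mon_val (px t) (py t) m.

Definition generic_point : #|mons|.-tuple A :=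
  [tuple generic_coord (val (val (enum_val i))) | i < #|mons|].

(** Every combination of s points is a specialization of the generic one. *)
Lemma coords_secant_vanish (p : {mpoly K[#|mons|]}) G :
  p \mPo generic_point = 0 -> in_span_of_points d1 d s G ->
  p.@[coordsF G] = 0.
Proof.
move=> p0 [pt [c [Hpt ->]]].
have [w Hw] : exists w : 'I_s -> 'rV[K]_3 * ('I_n -> 'rV[K]_2),
    forall t, pt t = segre_veronese d1 d (w t).1 (w t).2.
  have H t : exists w : 'rV[K]_3 * ('I_n -> 'rV[K]_2), pt t = segre_veronese d1 d w.1 w.2.
    by have [u [v [_ _ ->]]] := Hpt t; exists (u, v).
  by have [w Hw] := boolp.choice H; exists w.
pose eps (k : 'I_#|param|) : K :=
  let: (t, k) := enum_val k in
  match k with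
  | inl (inl _) => c t
  | inl (inr j) => (w t).1 0 j
  | inr (i, j) => (w t).2 i 0 j
  end.
have := congr1 (meval eps) p0; rewrite meval0 comp_mpoly_meval => <-.
apply: meval_eq => i; rewrite tnth_mktuple /coords /generic_coord.
rewrite mevalM mevalC raddf_sum /= raddf_sum /= big_distrr /=.
apply: eq_bigr => t _; rewrite mcoeffZ Hw mcoeff_segre mevalM mulrCA.
rewrite /pc /pvar mevalXU /eps enum_rankK; congr (_ * (_ * _)).
rewrite (mon_val_rmorph (meval eps)) /mon_val; congr (_ * _).
  by apply: eq_bigr => j _; rewrite /= mevalXU /eps enum_rankK.
apply: eq_bigr => l _; apply: eq_bigr => j _.
by rewrite /= mevalXU /eps enum_rankK.
Qed.

Variable F : {mpoly K[nvars n]}.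
Hypothesis F_closure : zariski_closure d1 d (in_span_of_points d1 d s) F.

(** The closure is tested on homogeneous polynomials only, which suffices because
    the set of combinations of points is a cone. *)
Lemma coords_closure_vanish (p : {mpoly K[#|mons|]}) :
  p \mPo generic_point = 0 -> p.@[coordsF F] = 0.
Proof.
move=> p0; rewrite (@pihomog_partitionE _ _ mdeg (msize p) p) // raddf_sum big1 //= => e _.
apply: (F_closure (pihomogP _ e p)) => G [pt [c [Hpt EG]]].
apply: homog_part_vanishes => a.
have -> : p.@[fun i => a * coordsF G i] = p.@[coordsF (a *: G)].
  by apply: meval_eq => i; rewrite /coords mcoeffZ.
apply: coords_secant_vanish => //; exists pt, (fun t => a * c t); split=> //.
by rewrite EG scaler_sumr; apply: eq_bigr => t _; rewrite scalerA.
Qed.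

Local Notation frac := (@tofrac A).

(** If 1 were the value at the generic point of a polynomial p vanishing at F, then
    p - 1 would vanish at the generic point, hence at F. *)
Lemma closure_ring_ideal : exists P : ring_ideal L,
  (forall p : {mpoly K[#|mons|]}, in_ring P (frac (p \mPo generic_point))) /\
  (forall p : {mpoly K[#|mons|]}, p.@[coordsF F] = 0 ->
     in_ideal P (frac (p \mPo generic_point))).
Proof.
pose R x := exists p : {mpoly K[#|mons|]}, x = frac (p \mPo generic_point).
pose J x := exists2 p : {mpoly K[#|mons|]}, p.@[coordsF F] = 0 &
  x = frac (p \mPo generic_point).
unshelve eexists (@RingIdeal L R J _ _ _ _ _ _ _ _).
- by exists 1; rewrite !rmorph1.
- by move=> _ _ [p ->] [q ->]; exists (p - q); rewrite !rmorphB.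
- by move=> _ _ [p ->] [q ->]; exists (p * q); rewrite !rmorphM.
- by exists 0; rewrite ?rmorph0 ?meval0.
- move=> _ _ [p p0 ->] [q q0 ->]; exists (p - q); last by rewrite !rmorphB.
  by rewrite mevalB p0 q0 subrr.
- move=> _ _ [p ->] [q q0 ->]; exists (p * q); last by rewrite !rmorphM.
  by rewrite mevalM q0 mulr0.
- by move=> _ [p _ ->]; exists p.
- move=> [p p0 E]; have pE : p \mPo generic_point = 1.
    by apply/eqP; rewrite -(@tofrac_eq A) -E rmorph1.
  have := @coords_closure_vanish (p - 1).
  rewrite comp_mpolyB comp_mpoly1 pE subrr mevalB p0 meval1 => /(_ erefl).
  by move/eqP; rewrite sub0r oppr_eq0 oner_eq0.
by split=> [p|p p0] /=; exists p.
Qed.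

End LowerBound.

Section MonomialLowerBound.
Variables (K : numFieldType) (n d1 : nat) (d : 'I_n -> nat) (s : nat).
Variables (a0 a1 a2 : nat) (b0 b1 : 'I_n -> nat).
Hypotheses (a01 : (a1 <= a0)%N) (a12 : (a2 <= a1)%N).
Hypothesis b01 : forall i, (b1 i <= b0 i)%N.
Hypotheses (ad : (a0 + a1 + a2)%N = d1) (bd : forall i, (b0 i + b1 i)%N = d i).
Local Notation F := (monomial_tensor K a0 a1 a2 b0 b1).
Local Notation mons := (basis_mnm d1 d).

Local Notation frac := (@tofrac {mpoly K[#|param n s|]}).

(** A label th stands for the monomial of degree b_(i,1) in the i-th pair of
    variables with exponent [th i] of y_(i,1), for each i. *)
Definition ylabel : finType := fprod (fun i : 'I_n => 'I_(b1 i).+1).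

Lemma card_ylabel : #|ylabel| = (\prod_i (b1 i).+1)%N.
Proof. by rewrite card_fprod; apply: eq_bigr => i _; rewrite card_ord. Qed.

Lemma basis_index (m : 'X_{1..(nvars n)}) : has_multidegree d1 d m ->
  exists i : 'I_#|mons|, val (val (enum_val i)) = m.
Proof.
move=> hm; have bm : (mdeg m < (d1 + \sum_i d i).+1)%N.
  by rewrite (mdeg_multidegree hm).
pose x : mons := exist (fun m : 'X_{1..(nvars n) < _} => has_multidegree d1 d m)
  (BMultinom bm) hm.
by exists (enum_rank x); rewrite enum_rankK.
Qed.

(** The generic weighted evaluation, corrected by the constant [segre_coef] of F,
    reduces to the functional dual to the monomial F. *)
Theorem secant_monomial_lower :
  zariski_closure d1 d (in_span_of_points d1 d s) F ->
  (a1.+1 * a2.+1 * \prod_i (b1 i).+1 <= s)%N.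
Proof.
move=> cl; have [P0 [ring0 ideal0]] := closure_ring_ideal cl.
have [P [[domR domI] valV]] := valuation_dominating P0.
pose a (l : 'I_3) := nth 0%N [:: a0; a1; a2] l.
pose mF := tensor_mnm a0 a1 a2 b0 b1.
pose cst (k : K) := frac k%:MP.
have cst_ring k : in_ring P (cst k).
  by apply/domR; have := ring0 k%:MP; rewrite comp_mpolyC.
pose u (t : 'I_s) j := frac (px K n t j).
pose v (t : 'I_s) i j := frac (py K t i j).
pose c (t : 'I_s) := cst (segre_coef K d1 d mF) * frac (pc K n t).
(* The values of the label th, and of the factor of the y-part of F that is
   complementary to th. *)
pose Y (th : ylabel) (t : 'I_s) :=
  \prod_i (v t i 0 ^+ (b1 i - th i) * v t i 1 ^+ th i).
pose Y' (th : ylabel) (t : 'I_s) :=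
  \prod_i (v t i 0 ^+ (b0 i - b1 i + th i) * v t i 1 ^+ (b1 i - th i)).
rewrite -card_ylabel.
apply: (@number_of_points _ P valV ylabel s c u Y Y' a) => //.
  move=> t; rewrite /u tofrac_eq0 /px /pvar; apply/eqP => E.
  have := congr1 (meval (fun=> 1)) E; rewrite mevalXU meval0.
  exact/eqP/oner_neq0.
move=> z th th' sz.
pose m := mk_mnm z (fun i j => nth 0%N [:: b0 i + th' i - th i; b1 i + th i - th' i]%N j).
have le_th (q : ylabel) i : (q i <= b1 i)%N by rewrite -ltnS ltn_ord.
have hm : has_multidegree d1 d m.
  apply/andP; split.
    under eq_bigr do rewrite mk_mnm_x.
    by rewrite sz -ad sum3.
  apply/forallP => i; rewrite !big_ord_recl big_ord0 !mk_mnm_y /= -bd.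
  by have := le_th th i; have := le_th th' i; have := b01 i; lia.
have Em : [forall l, z l == a l] && (th == th') = (mF == m).
  apply/andP/eqP => [[/forallP za /eqP eth]|E].
    apply: mnm_xyP => [j|i j]; rewrite ?mk_mnm_x ?mk_mnm_y; first exact/esym/eqP.
    by rewrite eth !addnK.
  split.
    apply/forallP => l; have <- : m (xvar n l) = z l by exact: mk_mnm_x.
    by rewrite -E mk_mnm_x.
  apply/eqP/fprodP => i; apply: val_inj => /=.
  have := congr1 (fun q : 'X_{1..(nvars n)} => q (yvar i 1)) E; rewrite !mk_mnm_y /=.
  by have := le_th th i; have := le_th th' i; lia.
have Emon t : mon_val (u t) (v t) m = (\prod_l u t l ^+ z l) * Y th t * Y' th' t.
  rewrite /mon_val -mulrA -big_split /=; congr (_ * _).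
    by apply: eq_bigr => l _; rewrite mk_mnm_x.
  apply: eq_bigr => i _; rewrite !big_ord_recl big_ord0 mulr1 !mk_mnm_y /=.
  rewrite mulrACA -!exprD; congr (_ ^+ _ * _ ^+ _).
  - by have := le_th th i; have := b01 i; lia.
  - by congr (v t i _); apply: val_inj.
  - by have := le_th th i; have := le_th th' i; lia.
have [i0 Ei0] := basis_index hm.
pose p : {mpoly K[#|mons|]} := 'X_i0 - ((mF == m)%:R)%:MP.
have Ip : in_ideal P (frac (p \mPo generic_point K d1 d s)).
  apply/domI/ideal0; rewrite mevalB mevalXU mevalC /coords Ei0 monomial_tensorE.
  by rewrite mcoeffX subrr.
have Ep : frac (p \mPo generic_point K d1 d s) =
   cst (segre_coef K d1 d m) * (\sum_t frac (pc K n t) * mon_val (u t) (v t) m)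
   - (mF == m)%:R.
  rewrite comp_mpolyB comp_mpolyC comp_mpolyXU -tnth_nth tnth_mktuple Ei0.
  rewrite rmorphB mpolyC_nat rmorph_nat; congr (_ - _).
  rewrite rmorphM; congr (_ * _); rewrite rmorph_sum; apply: eq_bigr => t _.
  by rewrite rmorphM (@mon_val_rmorph _ _ _ frac).
have Cm := segre_coef_neq0 K hm.
have := in_idealM (cst_ring (segre_coef K d1 d mF / segre_coef K d1 d m)) Ip.
rewrite Ep Em; congr (in_ideal P _).
rewrite mulrBr mulrA /cst -rmorphM -mpolyCM divfK // big_distrr /=; congr (_ - _).
  by apply: eq_bigr => t _; rewrite Emon /c /cst !mulrA.
case: eqP => [<-|_]; last by rewrite mulr0.
rewrite divff ?mulr1 ?rmorph1 //.
by apply: segre_coef_neq0; apply: tensor_mnm_multidegree.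
Qed.

End MonomialLowerBound.

(** * The degenerating family and the upper bound *)

Lemma prod_sum_fprod (K : comPzRingType) (I : finType) (T_ : I -> finType)
  (F : forall i, T_ i -> K) :
  \prod_i \sum_(q : T_ i) F i q = \sum_(f : fprod T_) \prod_i F i (f i).
Proof.
pose P_ i : {ffun T_ i -> K} := [ffun q => F i q].
transitivity (\sum_(f : fprod T_) \prod_(i in I) P_ i (f i)).
  rewrite (@big_fprod _ 0 1 *%R +%R).
  rewrite -(bigA_distr_big_dep (tagged_with T_) (fun i => untag 0 (P_ i))).
  apply: eq_bigr => i _; rewrite -(big_tag (fun i => P_ i)).
  by apply: eq_bigr => q _; rewrite ffunE.
by apply: eq_bigr => f _; apply: eq_bigr => i _; rewrite ffunE.
Qed.

(** A linear system with a Vandermonde matrix at the nodes 0, ..., N. *)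
Lemma moment_weights (K : numFieldType) N : exists c : 'I_N.+1 -> K,
  forall i, (i <= N)%N -> \sum_p c p * p%:R ^+ i = (i == N)%:R.
Proof.
pose nodes : 'rV[K]_N.+1 := \row_p p%:R.
pose V := Vandermonde N.+1 nodes.
have Vu : V \in unitmx.
  rewrite unitmxE unitfE det_Vandermonde; apply/prodf_neq0 => i _.
  apply/prodf_neq0 => j ij; rewrite !mxE subr_eq0 eqr_nat.
  by rewrite gtn_eqF.
pose c := invmx V *m delta_mx ord_max (0 : 'I_1).
exists (fun p => c p 0) => i iN.
have := congr1 (fun M : 'cV[K]_N.+1 => M (inord i) 0) (mulKVmx Vu (delta_mx ord_max 0)).
rewrite -/c !mxE eqxx andbT -val_eqE /= inordK // => <-.
by apply: eq_bigr => p _; rewrite !mxE inordK // mulrC.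
Qed.

Section UpperBound.
Variables (K : numFieldType) (n d1 : nat) (d : 'I_n -> nat).
Variables (a0 a1 a2 : nat) (b0 b1 : 'I_n -> nat).
Hypotheses (ad : (a0 + a1 + a2)%N = d1) (bd : forall i, (b0 i + b1 i)%N = d i).
Local Notation F := (monomial_tensor K a0 a1 a2 b0 b1).
Local Notation mons := (basis_mnm d1 d).
Local Notation coordsF := (@coords K n d1 d).

Lemma in_span_finType (I : finType) (p : I -> {mpoly K[nvars n]}) (c : I -> K) :
  (forall i, in_X d1 d (p i)) ->
  in_span_of_points d1 d #|I| (\sum_i c i *: p i).
Proof.
move=> Hp; exists (fun k => p (enum_val k)), (fun k => c (enum_val k)); split=> //.
transitivity (\sum_(i in I) c i *: p i); first exact: eq_bigl.
by rewrite big_enum_val.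
Qed.

Lemma meval_horner (N : nat) (p : {mpoly K[N]}) (g : 'I_N -> {poly K}) (t : K) :
  (mmap (@polyC K) g p).[t] = p.@[fun i => (g i).[t]].
Proof.
rewrite mevalE /mmap horner_sum; apply: eq_bigr => m _.
rewrite hornerM hornerC /mmap1 horner_prod; congr (_ * _).
by apply: eq_bigr => i _; rewrite horner_exp.
Qed.

(** The combination G at parameter t agrees with the value at t of the polynomials g,
    for t nonzero; a homogeneous p vanishing on all combinations then vanishes
    along g for infinitely many t, hence at t = 0, where g gives F. *)
Theorem monomial_in_secant_closure :
  zariski_closure d1 d
    (in_span_of_points d1 d (a1.+1 * a2.+1 * \prod_i (b1 i).+1)) F.
Proof.
have [c1 Hc1] := moment_weights K a1.
have [c2 Hc2] := moment_weights K a2.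
have [cy Hcy] : exists cy : forall i, 'I_(b1 i).+1 -> K, forall i k, (k <= b1 i)%N ->
    \sum_p cy i p * p%:R ^+ k = (k == b1 i)%:R.
  pose w i := boolp.cid (moment_weights K (b1 i)).
  by exists (fun i => sval (w i)) => i; exact: svalP (w i).
pose M1 k := \sum_p c1 p * p%:R ^+ k.
pose M2 k := \sum_p c2 p * p%:R ^+ k.
pose My i k := \sum_p cy i p * p%:R ^+ k.
have M1_0 k : M1 k != 0 -> (a1 <= k)%N.
  by apply: contraR; rewrite -ltnNge => ka; rewrite /M1 Hc1 ?(ltnW ka) // ltn_eqF.
have M2_0 k : M2 k != 0 -> (a2 <= k)%N.
  by apply: contraR; rewrite -ltnNge => ka; rewrite /M2 Hc2 ?(ltnW ka) // ltn_eqF.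
have My_0 i k : My i k != 0 -> (b1 i <= k)%N.
  by apply: contraR; rewrite -ltnNge => ka; rewrite /My Hcy ?(ltnW ka) // ltn_eqF.
pose mF := tensor_mnm a0 a1 a2 b0 b1.
have hF : has_multidegree d1 d mF by apply: tensor_mnm_multidegree.
pose C := segre_coef K d1 d.
pose moment (m : 'X_{1..(nvars n)}) : K :=
  M1 (m (xvar n 1%R)) * M2 (m (xvar n 2%R)) * \prod_i My i (m (yvar i 1%R)).
pose wt (m : 'X_{1..(nvars n)}) : nat :=
  (m (xvar n 1%R) + m (xvar n 2%R) + \sum_i m (yvar i 1%R))%N.
pose A := wt mF.
(* The subtraction in the exponent is truncated only where the moment is zero. *)
pose g (m : 'X_{1..(nvars n)}) : {poly K} := (C m / C mF * moment m) *: 'X^(wt m - A).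
have AE : A = (a1 + a2 + \sum_i b1 i)%N.
  by rewrite /A /wt !mk_mnm_x /=; congr (_ + _)%N; apply: eq_bigr => i _; rewrite mk_mnm_y.
have moment_wt m : moment m != 0 -> [/\ (a1 <= m (xvar n 1%R))%N,
    (a2 <= m (xvar n 2%R))%N & forall i, (b1 i <= m (yvar i 1%R))%N].
  rewrite /moment !mulf_eq0 !negb_or => /andP [/andP [/M1_0 h1 /M2_0 h2] /prodf_neq0 h3].
  by split=> // i; apply: My_0; apply: h3.
have wtA m : moment m != 0 -> (A <= wt m)%N.
  move=> /moment_wt [h1 h2 h3]; rewrite AE /wt; apply: leq_add; first exact: leq_add.
  exact: leq_sum.
have gF m : has_multidegree d1 d m -> (g m).[0] = F@_m.
  move=> hm; rewrite monomial_tensorE mcoeffX -/mF.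
  rewrite /g hornerZ hornerXn; case: (eqVneq mF m) => [<-|ne].
    rewrite subnn expr0 mulr1 divff ?segre_coef_neq0 // mul1r /moment.
    rewrite !mk_mnm_x /= /M1 Hc1 // /M2 Hc2 // !eqxx !mul1r big1 // => k _.
    by rewrite mk_mnm_y /= /My Hcy // eqxx.
  have [->|nz] := eqVneq (moment m) 0; first by rewrite mulr0 mul0r.
  have [h1 h2 h3] := moment_wt _ nz.
  suff : (A < wt m)%N by rewrite -subn_gt0 expr0n lt0n => /negPf ->; rewrite mulr0.
  (* In the extremal weight all small exponents are equal to those of F, and the
     multidegree determines the other ones. *)
  rewrite ltn_neqAle wtA // andbT; apply: contra ne => /eqP EA.
  have E12 : (m (xvar n 1%R) = a1 /\ m (xvar n 2%R) = a2 /\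
      \sum_i m (yvar i 1%R) = \sum_i b1 i)%N.
    have : (\sum_i b1 i <= \sum_i m (yvar i 1%R))%N by exact: leq_sum.
    by move: EA; rewrite AE /wt; lia.
  have [e1 [e2 e3]] := E12.
  have e4 i' : m (yvar i' 1%R) = b1 i'.
    have le_sum := leqif_sum (fun i (_ : true) => leqif_eq (h3 i)).
    have := eq_leqif le_sum; rewrite e3 eqxx => /esym/forallP /(_ i').
    by move=> /eqP.
  case/andP: hm => /eqP hx /forallP hy.
  apply/eqP/mnm_xyP => [j|i' j].
    rewrite mk_mnm_x; case: (ord3P j) => -> //=.
    by move: hx; rewrite sum3 e1 e2 -ad; lia.
  rewrite mk_mnm_y; have /eqP := hy i'; rewrite !big_ord_recl big_ord0 -bd.
  have -> : lift ord0 ord0 = 1 :> 'I_2 by exact: val_inj.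
  have := e4 i'; case: j => [[|[|//]] jl] /=.
    have -> : Ordinal jl = ord0 by exact: val_inj.
    by lia.
  by have -> : Ordinal jl = 1 by exact: val_inj.
move=> e p _ Hp.
pose q := mmap (@polyC K) (fun i : 'I_#|mons| => g (val (val (enum_val i)))) p.
have q0 : q = 0.
  apply: poly_eq0_nat => k; set t : K := k.+1%:R.
  have t0 : t != 0 by rewrite pnatr_eq0.
  pose I : finType := ('I_a1.+1 * 'I_a2.+1 * ylabel b1)%type.
  pose u (i : I) : 'rV[K]_3 := \row_j nth 0 [:: 1; t * i.1.1%:R; t * i.1.2%:R] j.
  pose v (i : I) l : 'rV[K]_2 := \row_j nth 0 [:: 1; t * (i.2 l)%:R] j.
  pose cf (i : I) : K := (C mF)^-1 * t ^- A * (c1 i.1.1 * c2 i.1.2 * \prod_l cy l (i.2 l)).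
  pose G := \sum_i cf i *: segre_veronese d1 d (u i) (v i).
  have GS : in_span_of_points d1 d (a1.+1 * a2.+1 * \prod_i (b1 i).+1) G.
    have -> : (a1.+1 * a2.+1 * \prod_i (b1 i).+1)%N = #|I|.
      by rewrite !card_prod !card_ord card_ylabel.
    apply: in_span_finType => i; exists (u i), (v i); split=> // [|l].
      by apply/eqP => /rowP /(_ 0) /eqP; rewrite !mxE /= oner_eq0.
    by apply/eqP => /rowP /(_ 0) /eqP; rewrite !mxE /= oner_eq0.
  suff gG m : (g m).[t] = G@_m.
    by rewrite meval_horner -[RHS](Hp _ GS); apply: meval_eq => i; apply: gG.
  rewrite raddf_sum /=.
  have valE (x : I) : mon_val (u x 0) (fun l => v x l 0) m =
     t ^+ wt m * (x.1.1%:R ^+ m (xvar n 1%R) * x.1.2%:R ^+ m (xvar n 2%R) *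
       \prod_l (x.2 l)%:R ^+ m (yvar l 1%R)).
    rewrite /mon_val !big_ord_recl big_ord0 !mxE /= expr1n mul1r mulr1.
    have -> : lift ord0 ord0 = 1 :> 'I_3 by exact: val_inj.
    have -> : lift ord0 (lift ord0 ord0) = 2%R :> 'I_3 by exact: val_inj.
    have -> : \prod_l \prod_j v x l 0 j ^+ m (yvar l j) =
       t ^+ (\sum_l m (yvar l 1%R)) * \prod_l (x.2 l)%:R ^+ m (yvar l 1%R).
      rewrite -prodrXr -big_split; apply: eq_bigr => l _.
      rewrite !big_ord_recl big_ord0 !mxE /= expr1n mul1r mulr1 -exprMn.
      by congr (_ ^+ m (yvar l _)); exact: val_inj.
    rewrite !exprMn /wt !exprD; by ring.
  have sumE : \sum_(x : I) (c1 x.1.1 * c2 x.1.2 * \prod_l cy l (x.2 l)) *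
     (x.1.1%:R ^+ m (xvar n 1%R) * x.1.2%:R ^+ m (xvar n 2%R) *
       \prod_l (x.2 l)%:R ^+ m (yvar l 1%R)) = moment m.
    rewrite /moment /M1 /M2 /My prod_sum_fprod big_distrlr /= pair_big big_distrlr /=.
    rewrite pair_big /=; apply: eq_bigr => x _.
    rewrite big_split /=; by ring.
  transitivity (C m / C mF * t ^- A * t ^+ wt m * moment m).
    rewrite /g hornerZ hornerXn.
    have [->|nz] := eqVneq (moment m) 0; first by rewrite !mulr0 mul0r.
    rewrite -{2}(subnK (wtA _ nz)) exprD.
    move: (t ^+ (wt m - A)) (t ^+ A) (expf_neq0 A t0) (C m / C mF) => x y y0 w.
    by field.
  rewrite -sumE big_distrr /=; apply: eq_bigr => x _.
  rewrite mcoeffZ mcoeff_segre -/(C m) (valE x) /cf; by ring.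
have := congr1 (fun r : {poly K} => r.[0]) q0; rewrite meval_horner horner0 => <-.
by apply: meval_eq => i; exact/esym/(gF _ (valP (enum_val i))).
Qed.

End UpperBound.

(** * The border rank *)

Local Open Scope complex_scope.

Theorem theorem1p4 (R : realType) (k : nat) (hk : (1 <= k)%N)
  (d1 : nat) (d : 'I_k.-1 -> nat)
  (hd1 : (0 < d1)%N) (hd : forall i, (0 < d i)%N)
  (a0 a1 a2 : nat) (b0 b1 : 'I_k.-1 -> nat)
  (ha01 : (a1 <= a0)%N) (ha12 : (a2 <= a1)%N)
  (hb : forall i, (b1 i <= b0 i)%N)
  (had : (a0 + a1 + a2)%N = d1)
  (hbd : forall i, (b0 i + b1 i)%N = d i) :
  is_border_rank d1 d (monomial_tensor R[i] a0 a1 a2 b0 b1)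
    ((a1 + 1) * (a2 + 1) * \prod_(i < k.-1) (b1 i + 1))%N.
Proof.
have -> : ((a1 + 1) * (a2 + 1) * \prod_(i < k.-1) (b1 i + 1) =
    a1.+1 * a2.+1 * \prod_(i < k.-1) (b1 i).+1)%N.
  by rewrite !addn1; congr (_ * _)%N; apply: eq_bigr => i _; rewrite addn1.
split=> [|s [_ _]]; last exact: secant_monomial_lower.
split; last exact: monomial_in_secant_closure.
  by rewrite monomial_tensorE /is_tensor msuppX /= tensor_mnm_multidegree.
by rewrite monomial_tensorE -msupp_eq0 msuppX.
Qed.
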